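(* Let $X$ be a uniformly convex and uniformly smooth Banach space whose normalized duality map $J$ is strongly monotone with value $M>0$, i.e. $\langle x-y,Jx-Jy\rangle\geq M\|x-y\|^2$ for all $x,y\in X$. Let $A:X\to 2^X$ be m-accretive such that $A$ satisfies the convergence condition and $A^{-1}0\neq\emptyset$. Let $\mathcal{S}_{1/2}=\{S_{1/2}(t)\mid t\geq 0\}$ be the semigroup generated by $A_{1/2}$ (the square root of $A$) via the exponential formula. Then every almost-orbit $u(t)$ of $\mathcal{S}_{1/2}$ converges strongly as $t\to\infty$.
   Context: The normalized duality map of $X$ is $J(x)=\{x^*\in X^*\mid \langle x,x^*\rangle=\|x\|^2,\ \|x^*\|=\|x\|\}$; it is single-valued since $X$ is uniformly smooth. A set-valued operator $A:X\to 2^X$ is identified with its graph, so $(x,y)\in A$ means $y\in Ax$. It is accretive if $\langle y_1-y_2,J(x_1-x_2)\rangle\geq 0$ for all $(x_1,y_1),(x_2,y_2)\in A$, and m-accretive if in addition $\mathrm{ran}(\mathrm{Id}+\gamma A)=X$ for all $\gamma>0$. Write $\mathrm{dom}A=\{x\mid Ax\neq\emptyset\}$ and $A^{-1}0=\{x\mid 0\in Ax\}$; $P$ denotes the nearest point projection onto the (nonempty, closed, convex) set $A^{-1}0$. Convergence condition: $A$ satisfies the convergence condition if for all bounded sequences $(x_n,y_n)\subseteq A$ with $\lim_{n\to\infty}\langle y_n,J(x_n-Px_n)\rangle=0$ it holds that $\liminf_{n\to\infty}\|x_n-Px_n\|=0$. The semigroup $\mathcal{S}_{1/2}$ and the operator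 $A_{1/2}$: if $X$ is a uniformly convex and uniformly smooth Banach space whose normalized duality map $J$ is strongly monotone (i.e. $\langle x-y,Jx-Jy\rangle\geq M\|x-y\|^2$ for all $x,y\in X$, for some $M>0$) and $A:X\to 2^X$ is m-accretive with $A^{-1}0\neq\emptyset$, then for $x\in\mathrm{dom}A$ the incomplete second-order Cauchy problem $$u''(t)\in Au(t)\ (0<t<\infty),\qquad u(0)=x,\qquad \sup\{\|u(t)\|\mid t\geq 0\}<\infty,$$ has a unique solution $u_x$ (the inclusion being satisfied for almost every $t$, in the usual strong sense), and $x\mapsto u_x(t)$, $t\ge 0$, defines a nonlinear semigroup of nonexpansive maps on $\mathrm{dom}A$, which extends by continuity to $\overline{\mathrm{dom}A}$ (Poffald and Reich). This semigroup is generated by a unique m-accretive operator, denoted $A_{1/2}$ and called the square root of $A$, via the exponential formula $S_{1/2}(t)x=\lim_{n\to\infty}(\mathrm{Id}+\frac{t}{n}A_{1/2})^{-n}x$; the semigroup is denoted $\mathcal{S}_{1/2}=\{S_{1/2}(t)\mid t\geq 0\}$. Almost-orbit: an almost-orbit of $\mathcal{S}_{1/2}$ is a continuous function $u:[0,\infty)\to\overline{\mathrm{dom}A}$ such that $\lim_{s\to\infty}\sup\{\|u(t+s)-S_{1/2}(t)u(s)\|\mid t\geq 0\}=0$. *)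

(* Defs.v *)
From mathcomp Require Import all_boot all_order all_algebra.
From mathcomp Require Import all_classical all_reals all_analysis.

Set Implicit Arguments.
Unset Strict Implicit.
Unset Printing Implicit Defensive.

Import Order.TTheory GRing.Theory Num.Theory.
Import numFieldNormedType.Exports.

Local Open Scope classical_set_scope.
Local Open Scope ring_scope.

Section geometry.
Context {R : realType} (X : normedModType R).

Definition uniformly_convex : Prop :=
  forall e : R, 0 < e -> exists2 d : R, 0 < d &
    forall x y : X, `|x| <= 1 -> `|y| <= 1 -> e <= `|x - y| ->
      `|2^-1 *: (x + y)| <= 1 - d.

(* The modulus of smoothness
   rho(t) = sup {(`|x + y| + `|x - y|) / 2 - 1 | `|x| = 1, `|y| = t}
   satisfies rho(t) / t --> 0 as t --> 0+. *)
Definition uniformly_smooth : Prop :=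
  forall e : R, 0 < e -> exists2 d : R, 0 < d &
    forall x y : X, `|x| = 1 -> `|y| <= d ->
      `|x + y| + `|x - y| <= 2 + e * `|y|.

Definition dual : set (X -> R) := [set f : X -> R | scalar f /\ continuous f].

Definition dual_norm (f : X -> R) : R :=
  sup [set `|f x| | x in [set x : X | `|x| <= 1]].

Definition duality_set (x : X) : set (X -> R) :=
  [set f : X -> R | [/\ dual f, f x = `|x| ^+ 2 & dual_norm f = `|x|]].

(* The duality set is a singleton when X is uniformly smooth; the default
   value (the zero functional) is then never used. The pairing <y, J x> is
   the application [J x y]. *)
Definition J (x : X) : X -> R := xget (fun=> 0) (duality_set x).

Definition strongly_monotone_duality (M : R) : Prop :=
  forall x y : X, M * `|x - y| ^+ 2 <= (J x - J y) (x - y).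

Definition nearest_point (C : set X) (x : X) : X :=
  xget 0 [set p | C p /\ forall q, C q -> `|x - p| <= `|x - q|].

End geometry.

Section operators.
Context {R : realType} {X : normedModType R}.
Implicit Types (A B : X -> set X) (S T : R -> X -> X).

Definition dom A : set X := [set x | A x !=set0].

Definition zeros A : set X := [set x | A x 0].

Definition accretive A : Prop :=
  forall x1 y1 x2 y2, A x1 y1 -> A x2 y2 -> 0 <= J (x1 - x2) (y1 - y2).

Definition m_accretive A : Prop :=
  accretive A /\
  forall g : R, 0 < g -> forall x, exists z y, A z y /\ x = z + g *: y.

Definition convergence_condition A : Prop :=
  let P := nearest_point (zeros A) in
  forall x y : nat -> X, (forall n, A (x n) (y n)) ->
    bounded_fun x -> bounded_fun y ->
    J (x n - P (x n)) (y n) @[n --> \oo] --> (0 : R) ->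
    limn_inf (fun n => `|x n - P (x n)|) = 0.

Definition resolvent A (g : R) (x : X) : X :=
  xget 0 [set z | exists2 y, A z y & x = z + g *: y].

Definition absolutely_continuous (a b : R) (f : R -> X) : Prop :=
  forall e : R, 0 < e -> exists2 d : R, 0 < d &
    forall (n : nat) (s t : 'I_n -> R),
      (forall i, a <= s i /\ s i <= t i /\ t i <= b) ->
      trivIset setT (fun i => `]s i, t i[%classic) ->
      \sum_(i < n) (t i - s i) < d ->
      \sum_(i < n) `|f (t i) - f (s i)| < e.

(* Strong solutions of u'' \in A u on ]0, +oo[, u(0) = x, u bounded: u is
   continuous up to 0, differentiable on ]0, +oo[, u' is locally absolutely
   continuous there, and u'' exists and satisfies the inclusion almost
   everywhere. Only the values of u on [0, +oo[ matter. *)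
Definition incomplete_cauchy_solution A (x : X) (u : R -> X) : Prop :=
  [/\ u 0 = x,
      {within `[0, +oo[, continuous u},
      exists K : R, forall t, 0 <= t -> `|u t| <= K,
      (forall t, 0 < t -> derivable u t 1) /\
      (forall a b, 0 < a -> a < b -> absolutely_continuous a b (derive1 u)) &
      {ae @lebesgue_measure R, forall t, 0 < t ->
        derivable (derive1 u) t 1 /\ A (u t) (derive1n 2 u t)}].

Definition nonexpansive_semigroup (C : set X) S : Prop :=
  [/\ forall t x, 0 <= t -> C x -> C (S t x),
      forall x, C x -> S 0 x = x,
      forall s t x, 0 <= s -> 0 <= t -> C x -> S (s + t) x = S s (S t x),
      forall x, C x -> {within `[0, +oo[, continuous (S ^~ x)} &
      forall t x y, 0 <= t -> C x -> C y -> `|S t x - S t y| <= `|x - y|].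

Definition incomplete_cauchy_semigroup A S : Prop :=
  nonexpansive_semigroup (closure (dom A)) S /\
  forall x, dom A x -> incomplete_cauchy_solution A x (S ^~ x).

(* At t = 0 the iterated resolvent is read as the identity. *)
Definition generates B S : Prop :=
  forall x, closure (dom B) x ->
    S 0 x = x /\
    forall t, 0 < t ->
      iter n (resolvent B (t / n%:R)) x @[n --> \oo] --> S t x.

(* B = A_{1/2}: the exponential formula for B yields, on
   closure (dom B) = closure (dom A), the semigroup x |-> u_x(t) given by
   the incomplete Cauchy problem for A. *)
Definition square_root A B : Prop :=
  [/\ m_accretive B,
      closure (dom B) = closure (dom A) &
      exists T, incomplete_cauchy_semigroup A T /\ generates B T].

(* The supremum is taken in \bar R: a real-valued sup would be 0 on
   unbounded sets. *)
Definition almost_orbit (C : set X) S (u : R -> X) : Prop :=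
  [/\ {within `[0, +oo[, continuous u},
      forall t, 0 <= t -> C (u t) &
      ereal_sup [set (`|u (t + s) - S t (u s)|)%:E | t in `[0, +oo[%classic]
        @[s --> +oo] --> 0%E].

End operators.

(* Main.v *)
Require Import Defs.
From mathcomp Require Import all_boot all_order all_algebra.
From mathcomp Require Import all_classical all_reals all_analysis.
From mathcomp Require Import ring lra.

Set Implicit Arguments.
Unset Strict Implicit.
Unset Printing Implicit Defensive.

Import Order.TTheory GRing.Theory Num.Theory.
Import numFieldNormedType.Exports.

Local Open Scope classical_set_scope.
Local Open Scope ring_scope.

(** Let v be a bounded solution of v'' in A v and z either v - p, with p a zero
   of A, or v(. + h) - v. Accretivity and strong monotonicity of J give
   [<z', J z>' >= <z'', J z> + M |z'|^2 >= M |z'|^2], so |z|^2 is convex and,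
   being bounded, nonincreasing. For z = v - p this shows
   |v(t) - p| <= |v(0) - p|, hence the zeros of A are fixed by the semigroup.
   For z = v(. + h) - v, dividing by h^2 and letting h tend to 0, it shows that
   the integral of |v''|^2 over [t, t + 1] is O(1/t); there are thus points
   t_n where the inclusion holds and v''(t_n) tends to 0, and the convergence
   condition applied to (v(t_n), v''(t_n)) yields liminf d(v, zeros A) = 0.
   Nonexpansiveness carries this over to almost-orbits, which are therefore
   Cauchy.

   Everywhere, "for almost every t" is handled without integrals: a function m
   of small total increase and of lower derivative at least 1 on the
   exceptional set absorbs the bad intervals in an interval induction. *)

(** * The normalized duality map *)

Section scalar_functions.
Context {R : realType} {X : normedModType R} (f : X -> R).
Hypothesis f_lin : scalar f.

Lemma scalar_fun0 : f 0 = 0.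
Proof. by have := f_lin (-1) 0 0; rewrite scaler0 addr0 => ->; ring. Qed.

Lemma scalar_funD x y : f (x + y) = f x + f y.
Proof. by have := f_lin 1 x y; rewrite scale1r mul1r. Qed.

Lemma scalar_funZ a x : f (a *: x) = a * f x.
Proof. by have := f_lin a x 0; rewrite !addr0 scalar_fun0 addr0. Qed.

Lemma scalar_funN x : f (- x) = - f x.
Proof. by rewrite -scaleN1r scalar_funZ mulN1r. Qed.

Lemma scalar_funB x y : f (x - y) = f x - f y.
Proof. by rewrite scalar_funD scalar_funN. Qed.

Lemma scalar_continuous_bounded : continuous f ->
  exists2 C : R, 0 < C & forall x, `|f x| <= C * `|x|.
Proof.
move=> /(_ 0) /cvgrPdist_lt /(_ 1 ltr01).
rewrite scalar_fun0 => /nbhs_ballP[d /= d0 fd].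
exists (2 / d); first by rewrite divr_gt0.
move=> x; have [->|x0] := eqVneq x 0.
  by rewrite scalar_fun0 normr0 normr0 mulr0.
have nx : 0 < `|x| by rewrite normr_gt0.
have k0 : 0 < d / 2 / `|x| by rewrite !divr_gt0.
have := fd ((d / 2 / `|x|) *: x).
rewrite /= -ball_normE /ball_ /= sub0r normrN normrZ gtr0_norm// divfK ?gt_eqF//.
rewrite ltr_pdivrMr// ltr_pMr// ltr1n => /(_ isT).
rewrite sub0r normrN scalar_funZ normrM gtr0_norm// mulrC -ltr_pdivlMr// => h.
apply: le_trans (ltW h) _; rewrite !invf_div mul1r.
by rewrite le_eqVlt; apply/orP; left; apply/eqP; field; rewrite !gt_eqF.
Qed.

End scalar_functions.

Section duality_map.
Context {R : realType} {X : normedModType R}.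
Implicit Types x y k : X.

Lemma le_dual_norm (f : X -> R) k : dual f -> `|f k| <= dual_norm f * `|k|.
Proof.
move=> [f_lin f_cont].
have [->|k0] := eqVneq k 0; first by rewrite scalar_fun0// !normr0 mulr0.
have nk : 0 < `|k| by rewrite normr_gt0.
have [C C0 fC] := scalar_continuous_bounded f_lin f_cont.
(* A real-valued [sup] is an upper bound only for bounded sets; the bound is the constant [C] given
   by continuity. *)
rewrite -ler_pdivrMr//; apply: ub_le_sup.
  exists C => _ [x /= x1 <-]; apply: le_trans (fC x) _.
  by rewrite ler_piMr// ltW.
exists (`|k|^-1 *: k); first by rewrite /= normrZ gtr0_norm ?invr_gt0// mulVf// gt_eqF.
by rewrite scalar_funZ// normrM gtr0_norm ?invr_gt0// mulrC.
Qed.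

Lemma J_scalar x : scalar (J x).
Proof.
rewrite /J; case: xgetP => [f _ [[]]|_ a u v]//.
by rewrite mulr0 addr0.
Qed.

Lemma J0 k : J (0 : X) k = 0.
Proof.
rewrite /J; case: xgetP => [f _ [df _ nf]|//].
by apply/eqP; rewrite -normr_le0 (le_trans (le_dual_norm _ df))// nf normr0 mul0r.
Qed.

Section strongly_monotone.
Context (M : R).
Hypotheses (M0 : 0 < M) (J_mono : strongly_monotone_duality X M).

Lemma J_monotone x y : M * `|x - y| ^+ 2 <= J x (x - y) - J y (x - y).
Proof. exact: J_mono. Qed.

(** No Hahn-Banach theorem is involved: were the duality set empty, [J x] would be the default 0,
    and strong monotonicity between [x] and 0 would give [M |x|^2 <= 0]. *)
Lemma J_in x : x != 0 -> duality_set x (J x).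
Proof.
move=> x0; have := J_monotone x 0; rewrite subr0 J0 subr0.
rewrite /J; case: xgetP => [f _ //|_].
by rewrite leNgt mulr_gt0// exprn_gt0// normr_gt0.
Qed.

Lemma J_self x : J x x = `|x| ^+ 2.
Proof.
have [->|/J_in[]//] := eqVneq x 0; by rewrite J0 normr0 expr0n.
Qed.

Lemma J_norm x k : `|J x k| <= `|x| * `|k|.
Proof.
have [->|/J_in[dJ _ nJ]] := eqVneq x 0; first by rewrite J0 !normr0 mul0r.
by rewrite -nJ; exact: le_dual_norm.
Qed.

Lemma J_le x k : J x k <= `|x| * `|k|.
Proof. exact: le_trans (ler_norm _) (J_norm _ _). Qed.

Lemma J_ge x k : - (`|x| * `|k|) <= J x k.
Proof. by have := J_norm x k; rewrite ler_norml => /andP[]. Qed.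

(** The functional [J (x - y)] already separates the two points. This reduces identities between
    linear combinations of vectors to scalar ones, within reach of [ring] and [field]. *)
Lemma scalar_separates x y : (forall f : X -> R, scalar f -> f x = f y) -> x = y.
Proof.
move=> /(_ _ (@J_scalar (x - y))) /eqP.
rewrite -subr_eq0 -(scalar_funB (@J_scalar _)) J_self sqrf_eq0 normr_eq0 subr_eq0.
by move/eqP.
Qed.

(** Young's inequality after [J x y <= |x| |y|]: the functional [2 J x] is a subgradient of the
    squared norm at [x]. *)
Lemma J_subgradient x y : `|x| ^+ 2 + 2 * J x (y - x) <= `|y| ^+ 2.
Proof.
rewrite (scalar_funB (@J_scalar x)) J_self.
have := J_le x y; have := sqr_ge0 (`|x| - `|y|); nra.
Qed.

(* Two subgradient inequalities at the midpoints of [m, a] and [m, b], where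
   m = (a + b) / 2, and strong monotonicity between these midpoints and m. *)
Lemma parallelogram_le (a b : X) :
  2 * `|2^-1 *: (a + b)| ^+ 2 + M / 4 * `|a - b| ^+ 2 <= `|a| ^+ 2 + `|b| ^+ 2.
Proof.
set m := 2^-1 *: (a + b); pose k := 4^-1 *: (a - b).
have Ea : a - (m + k) = k.
  apply: scalar_separates => f lf.
  by rewrite !(scalar_funD lf, scalar_funZ lf, scalar_funN lf); field.
have Eb : b - (m - k) = - k.
  apply: scalar_separates => f lf.
  by rewrite !(scalar_funD lf, scalar_funZ lf, scalar_funN lf); field.
have nk : `|a - b| = 4 * `|k|.
  by rewrite normrZ ger0_norm ?invr_ge0// mulrA divff ?mul1r// pnatr_eq0.
have := J_subgradient (m + k) a; rewrite Ea => ha.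
have := J_subgradient (m - k) b; rewrite Eb => hb.
have := J_subgradient m (m + k); rewrite [m + k - m]addrC addKr => hk.
have := J_subgradient m (m - k); rewrite [m - k - m]addrC addKr => hk'.
have := J_monotone (m + k) m; rewrite [m + k - m]addrC addKr => mk.
have := J_monotone (m - k) m; rewrite [m - k - m]addrC addKr normrN => mk'.
rewrite !(scalar_funN (@J_scalar _)) in hb hk' mk'.
rewrite nk; nra.
Qed.

(* If |k| = r := d |x| with d given by the smoothness for a small e', then
   J x (x + k) <= |x| |x + k| and J y (x - k) <= |y| |x - k|; adding up, the
   smoothness bounds J x k - J y k by a multiple of e' r + |x - y|. *)
Lemma J_continuous (smooth : uniformly_smooth X) x (e : R) : 0 < e ->
  exists2 d : R, 0 < d &
    forall y, `|y - x| < d -> forall k, `|J y k - J x k| <= e * `|k|.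
Proof.
move=> e0; have [->|x0] := eqVneq x 0.
  exists e => // y; rewrite subr0 => ye k; rewrite J0 subr0.
  by apply: le_trans (J_norm y k) _; rewrite ler_wpM2r// ltW.
set n := `|x|; have n0 : 0 < n by rewrite normr_gt0.
have [d d0 dP] := smooth _ (divr_gt0 e0 (mulr_gt0 (ltr0n R 4) n0)).
pose r := d * n; have r0 : 0 < r by rewrite mulr_gt0.
have xk k : `|k| = r -> `|x + k| + `|x - k| <= 2 * n + e / (4 * n) * r.
  move=> kr; have := dP (n^-1 *: x) (n^-1 *: k).
  rewrite -scalerDr -scalerBr !normrZ gtr0_norm ?invr_gt0// mulVf ?gt_eqF//.
  rewrite kr /r [n^-1 * _]mulrC mulfK ?gt_eqF// => /(_ erefl (lexx _)).
  rewrite -mulrDr mulrC ler_pdivrMr// => /le_trans; apply.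
  by rewrite mulrDl mulrA.
exists (Num.min n (e * r / (2 * (4 * n + r)))).
  by rewrite lt_min n0 !(divr_gt0, mulr_gt0, addr_gt0).
move=> y; rewrite lt_min => /andP[yn yx].
have bound k : `|k| = r -> J x k - J y k <= e * r.
  move=> kr; set N := `|y|; set D := `|y - x| in yn yx.
  have D0 : 0 <= D by exact: normr_ge0.
  have nN : n <= N + D.
    by rewrite -lerBlDl; apply: le_trans (lerB_dist _ _) _; rewrite distrC.
  have Nn : N <= n + D by rewrite -lerBlDl; exact: lerB_dist.
  have N0 : 0 <= N by exact: normr_ge0.
  have hx : J x k <= n * `|x + k| - n ^+ 2.
    by have := J_le x (x + k); rewrite (scalar_funD (@J_scalar x)) J_self -/n; lra.
  have hy : - J y k <= N * `|x - k| - N ^+ 2 + N * D.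
    have := J_le y (x - k); have := J_ge y (x - y).
    rewrite !(scalar_funB (@J_scalar y)) J_self distrC -/N -/D; lra.
  have hJ := J_le x k; rewrite kr -/n in hJ.
  have hxk := xk _ kr.
  have De : D * (2 * (4 * n + r)) <= e * r.
    by rewrite -ler_pdivlMr ?ltW// mulr_gt0// addr_gt0// mulr_gt0.
  have e4 : n * (e / (4 * n) * r) = e * r / 4 by field; rewrite gt_eqF.
  (* Weighting [hx] by [N] and [hy] by [n] gives both norms the common factor [n N], so that [xk]
     applies. The defect [n - N] is at most [D], and the radius chosen for [y] absorbs the terms in
     [D]. *)
  have key : n * (J x k - J y k) <= n * (e * r).
    have nNr : (n * N) * (`|x + k| + `|x - k|) <= (n * N) * (2 * n + e / (4 * n) * r).
      by rewrite ler_wpM2l// mulr_ge0// ltW.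
    have e5 : n * N * (e / (4 * n) * r) = N * (e * r / 4) by rewrite -e4; ring.
    rewrite [X in _ <= X]mulrDr e5 in nNr.
    have h1 : N * J x k <= N * (n * `|x + k| - n ^+ 2) by rewrite ler_wpM2l.
    have h2 : n * - J y k <= n * (N * `|x - k| - N ^+ 2 + N * D).
      by rewrite ler_wpM2l// ltW.
    have h3 : (n - N) * J x k <= D * (n * r).
      apply: le_trans (ler_norm _) _; rewrite normrM ler_pM//.
        by rewrite ler_norml; apply/andP; split; lra.
      by apply: le_trans (J_norm x k) _; rewrite kr.
    have h4 : n * N * (n - N) <= n * N * D by rewrite ler_wpM2l ?mulr_ge0 ?(ltW n0)//; lra.
    have h5 : N * (e * r / 4 + n * (2 * D)) <= (2 * n) * (e * r / 4 + n * (2 * D)).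
      rewrite ler_wpM2r//; last lra.
      by rewrite addr_ge0// ?mulr_ge0// ?ltW.
    have h6 : n * (D * (2 * (4 * n + r))) <= n * (e * r) by rewrite ler_wpM2l// ltW.
    lra.
  by rewrite -(ler_pM2l n0).
move=> k; have [->|k0] := eqVneq k 0.
  by rewrite !(scalar_fun0 (@J_scalar _)) subrr !normr0 mulr0.
have nk : 0 < `|k| by rewrite normr_gt0.
have c0 : 0 < r / `|k| by rewrite divr_gt0.
have nc : `|(r / `|k|) *: k| = r by rewrite normrZ gtr0_norm// divfK// gt_eqF.
have h1 := bound _ nc.
have h2 : J x (- ((r / `|k|) *: k)) - J y (- ((r / `|k|) *: k)) <= e * r.
  by apply: bound; rewrite normrN.
rewrite !(scalar_funN (@J_scalar _)) !(scalar_funZ (@J_scalar _)) in h1 h2.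
have er : e * r = (r / `|k|) * (e * `|k|) by field; rewrite gt_eqF.
by rewrite ler_norml; apply/andP; split; rewrite -(ler_pM2l c0) ?mulrN -er; lra.
Qed.

End strongly_monotone.
End duality_map.

(** * Nearest points and zeros of m-accretive operators *)

Section nearest_points.
Context {R : realType} {X : completeNormedModType R} (M : R).
Hypotheses (M0 : 0 < M) (J_mono : strongly_monotone_duality X M).

(** The centre may depend on [e] and lie off the curve; for almost-orbits it will be a zero of the
    operator. *)
Lemma cauchy_cvg_dist (T : Type) (F : set_system T) (FF : ProperFilter F)
    (f : T -> X) :
  (forall e : R, 0 < e -> exists x, \forall t \near F, `|x - f t| < e) ->
  exists l : X, f t @[t --> F] --> l.
Proof.
move=> fc; suff /cvg_ex[l fl] : cvg (f t @[t --> F]) by exists l.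
apply/cauchy_cvgP; apply: cauchy_exP => e e0.
by have [x xf] := fc e e0; exists x; rewrite -ball_normE.
Qed.

(** A minimising sequence is Cauchy: the midpoint of two of its terms stays in [C], hence at
    distance at least [d] from [x], and [parallelogram_le] then bounds the gap between the two
    terms. *)
Lemma nearest_pointP (C : set X) x : closed C -> C !=set0 ->
  (forall p q, C p -> C q -> C (2^-1 *: (p + q))) ->
  C (nearest_point C x) /\
  forall q, C q -> `|x - nearest_point C x| <= `|x - q|.
Proof.
move=> C_closed [p0 Cp0] C_mid.
suff [p Cp] : [set p | C p /\ forall q, C q -> `|x - p| <= `|x - q|] !=set0.
  by rewrite /nearest_point; case: xgetP => [z _|/(_ p)].
pose D := [set `|x - q| | q in C]; pose d := inf D.
have D_inf : has_inf D.
  by split; [exists `|x - p0|, p0 | exists 0 => _ [q _ <-]].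
have d_le q : C q -> d <= `|x - q|.
  by move=> Cq; apply: ge_inf; [case: D_inf|exists q].
have d0 : 0 <= d by apply: lb_le_inf; [case: D_inf|move=> _ [q _ <-]].
have /choice[q qP] n : exists q, C q /\ `|x - q| < d + n.+1%:R^-1.
  have [|_ [q Cq <-] qd] := @inf_adherent _ D n.+1%:R^-1 _ D_inf.
    by rewrite invr_gt0.
  by exists q.
have [|p qp] := @cauchy_cvg_dist _ \oo _ q.
  move=> e e0.
  (* With [i = 1 / (N + 1) <= 1], two terms of index at least [N] satisfy
     [M / 4 |q N - q n|^2 <= 2 (2 d + 1) i]; the bound [i < r] makes this less than [M e^2 / 4]. *)
  pose r := M * e ^+ 2 / (8 * (2 * d + 1)).
  have r0 : 0 < r.
    by rewrite divr_gt0// ?mulr_gt0// ?exprn_gt0// ltr_wpDl// mulr_ge0.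
  have [N _ NP] := near_infty_natSinv_lt (PosNum r0).
  exists (q N); exists N => // n /= Nn.
  have Ce := parallelogram_le M0 J_mono (x - q N) (x - q n).
  have := d_le _ (C_mid _ _ (qP N).1 (qP n).1).
  have -> : x - 2^-1 *: (q N + q n) = 2^-1 *: (x - q N + (x - q n)).
    apply: (scalar_separates M0 J_mono) => f lf.
    by rewrite !(scalar_funD lf, scalar_funZ lf, scalar_funN lf); field.
  have Eq : x - q N - (x - q n) = q n - q N.
    apply: (scalar_separates M0 J_mono) => f lf.
    by rewrite !(scalar_funD lf, scalar_funZ lf, scalar_funN lf); ring.
  move: Ce; rewrite Eq [`|q n - q N|]distrC.
  set m := `|2^-1 *: _| => Ce dm.
  have m1 : N.+1%:R^-1 <= 1 :> R by rewrite invf_le1// ler1n.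
  have i0 : 0 < N.+1%:R^-1 :> R by rewrite invr_gt0.
  have rN := NP N (leqnn N); rewrite /= /r ltr_pdivlMr in rN; last first.
    by rewrite mulr_gt0// ltr_wpDl// mulr_ge0.
  have hn : `|x - q n| <= d + N.+1%:R^-1.
    by apply: le_trans (ltW (qP n).2) _; rewrite lerD2l lef_pV2 ?posrE// ler_nat.
  have hN := ltW (qP N).2.
  have m2 : d ^+ 2 <= m ^+ 2 by rewrite lerXn2r ?nnegrE// ?normr_ge0.
  move: (N.+1%:R^-1) m1 i0 rN hn hN => i m1 i0 rN hn hN.
  have sq (y : X) : `|y| <= d + i -> `|y| ^+ 2 <= d ^+ 2 + (2 * d + 1) * i.
    move=> hy; have : `|y| ^+ 2 <= (d + i) ^+ 2.
      by rewrite lerXn2r ?nnegrE// addr_ge0// ltW.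
    have : i * i <= i by rewrite ler_piMr// ltW.
    lra.
  have := sq _ hn; have := sq _ hN => s1 s2.
  have : M * `|q N - q n| ^+ 2 < M * e ^+ 2 by lra.
  by rewrite ltr_pM2l// ltr_sqr ?nnegrE// ltW.
exists p; split.
  by apply: (closed_cvg _ C_closed) qp; apply: nearW => n; exact: (qP n).1.
move=> y Cy; apply: le_trans (d_le _ Cy).
apply/ler_addgt0Pr => e e0.
have e20 : 0 < e / 2 by rewrite divr_gt0.
have [N _ NP] := near_infty_natSinv_lt (PosNum e20).
have [N' _ NP'] := (cvgrPdist_lt _ _).1 qp _ e20.
pose n := maxn N N'.
have := NP n (leq_maxl _ _); have := NP' n (leq_maxr _ _) => /= h1 h2.
move: (qP n).2; move: (n.+1%:R^-1) h2 => i h2.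
by have := ler_distD (q n) x p; rewrite [`|q n - p|]distrC; lra.
Qed.

Section zeros.
Context (A : X -> set X).
Hypothesis A_macc : m_accretive A.

(* The resolvent of A is nonexpansive and fixes the zeros. *)
Lemma resolvent_zeros m : exists r, (r = m -> zeros A m) /\
  forall p, zeros A p -> `|r - p| <= `|m - p|.
Proof.
have [acc /(_ 1 ltr01 m)[r [y [Ary]]]] := A_macc.
rewrite scale1r => mE; exists r; split.
  move=> rm; move: Ary; rewrite rm /zeros /=.
  by move: mE; rewrite rm -[LHS]addr0 => /addrI <-.
move=> p Ap; have := acc _ _ _ _ Ary Ap; rewrite subr0.
have -> : y = (m - p) - (r - p) by rewrite mE opprB addrA subrK addrAC subrr add0r.
rewrite (scalar_funB (@J_scalar _ _ _)) (J_self M0 J_mono).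
have := J_le M0 J_mono (r - p) (m - p).
have := normr_ge0 (r - p); rewrite le_eqVlt => /predU1P[<- _ _|rp0].
  exact: normr_ge0.
move=> h1 h2; rewrite -(ler_pM2l rp0); lra.
Qed.

(** The point [r] attached to a limit point [p] is no farther than [p] from each zero; zeros
    arbitrarily close to [p] force [r = p]. *)
Lemma zeros_closed : closed (zeros A).
Proof.
move=> p Fp; have [r [rp]] := resolvent_zeros p; move=> rP; apply: rp.
apply/eqP; rewrite -subr_eq0 -normr_le0; apply/ler_addgt0Pr => e e0.
have [|q [/rP rq]] := Fp (ball p (e / 2)).
  by apply: nbhsx_ballx; rewrite divr_gt0.
rewrite -ball_normE /= => pq.
by have := ler_distD q r p; rewrite [`|q - p|]distrC; lra.
Qed.

(** The point [r] attached to the midpoint lies within [d = |p - q| / 2] of both [p] and [q]. By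
    [parallelogram_le] for [r - p] and [q - r], only the midpoint itself does. *)
Lemma zeros_midpoint p q : zeros A p -> zeros A q -> zeros A (2^-1 *: (p + q)).
Proof.
move=> Ap Aq; have [r [rm rP]] := resolvent_zeros (2^-1 *: (p + q)).
apply: rm.
have := rP p Ap; have := rP q Aq.
have -> : 2^-1 *: (p + q) - q = 2^-1 *: (p - q).
  apply: (scalar_separates M0 J_mono) => f lf.
  by rewrite !(scalar_funD lf, scalar_funZ lf, scalar_funN lf); field.
have -> : 2^-1 *: (p + q) - p = - (2^-1 *: (p - q)).
  apply: (scalar_separates M0 J_mono) => f lf.
  by rewrite !(scalar_funD lf, scalar_funZ lf, scalar_funN lf); field.
rewrite normrN -[`|r - q|]normrN; set d := `|2^-1 *: _| => rq rp.
have := parallelogram_le M0 J_mono (r - p) (- (r - q)).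
have -> : r - p - - (r - q) = 2 *: (r - 2^-1 *: (p + q)).
  apply: (scalar_separates M0 J_mono) => f lf.
  by rewrite !(scalar_funD lf, scalar_funZ lf, scalar_funN lf); field.
have -> : 2^-1 *: (r - p - (r - q)) = - (2^-1 *: (p - q)).
  apply: (scalar_separates M0 J_mono) => f lf.
  by rewrite !(scalar_funD lf, scalar_funZ lf, scalar_funN lf); field.
rewrite normrN -/d normrZ ger0_norm// exprMn => h.
have s1 : `|r - p| ^+ 2 <= d ^+ 2 by rewrite lerXn2r ?nnegrE ?normr_ge0.
have s2 : `|- (r - q)| ^+ 2 <= d ^+ 2 by rewrite lerXn2r ?nnegrE ?normr_ge0.
apply/eqP; rewrite -subr_eq0 -normr_eq0 -sqrf_eq0 eq_le sqr_ge0 andbT.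
by rewrite -(ler_pM2l M0) mulr0; lra.
Qed.

Lemma nearest_zeroP x : zeros A !=set0 ->
  zeros A (nearest_point (zeros A) x) /\
  forall q, zeros A q -> `|x - nearest_point (zeros A) x| <= `|x - q|.
Proof.
by move=> F0; apply: nearest_pointP => //; [exact: zeros_closed|exact: zeros_midpoint].
Qed.

End zeros.
End nearest_points.

(** * Interval induction and null sets *)

Section interval_functions.
Context {R : realType}.
Implicit Types (a b s t r : R) (l : seq (R * R)) (N : set R).

(** A form of Cousin's lemma: the local hypothesis at the supremum of the [c] with [P a c] reaches
    back to such a [c] and forward beyond the supremum, unless the latter is [b]. *)
Lemma interval_induction (P : R -> R -> Prop) a b : a <= b ->
  (forall s t r, a <= s -> s <= t -> t <= r -> r <= b ->
    P s t -> P t r -> P s r) ->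
  (forall t, a <= t -> t <= b -> exists2 d : R, 0 < d & forall s r,
    a <= s -> s <= t -> t <= r -> r <= b -> r - s < d -> P s r) ->
  P a b.
Proof.
move=> ab P_trans P_local.
pose E := [set c | a <= c /\ c <= b /\ P a c].
have Ea : E a.
  split=> //; split=> //; have [d d0] := P_local a (lexx a) ab.
  by apply=> //; rewrite subrr.
have E_sup : has_sup E by split; [exists a | exists b => c [_ []]].
have ac : a <= sup E by apply: ub_le_sup => //; case: E_sup.
have cb : sup E <= b by apply: ge_sup; [exists a|move=> c [_ []]].
have [d d0 dP] := P_local _ ac cb.
have d20 : 0 < d / 2 by rewrite divr_gt0.
have [c [ac' [cb' Pac]] cd] := sup_adherent d20 E_sup.
have c_le : c <= sup E by apply: ub_le_sup => //; case: E_sup.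
pose r := Num.min b (sup E + d / 2).
have rb : r <= b by rewrite /r ge_min lexx.
have cr : sup E <= r by rewrite /r le_min cb lerDl ltW.
have r_le : r <= sup E + d / 2 by rewrite /r ge_min lexx orbT.
have Pcr : P c r by apply: dP => //; lra.
have Par : P a r by apply: (P_trans a c r) => //; lra.
have : r <= sup E.
  by apply: ub_le_sup; [case: E_sup|split; [lra|split]].
rewrite /r ge_min gerDl [d / 2 <= 0]leNgt d20 orbF => bE.
by move: Par; rewrite /r min_l//; lra.
Qed.

(* Substitute for "N is negligible" that is manifestly invariant under
   translations. *)
Definition null_potential N := forall d : R, 0 < d -> exists m : R -> R,
  [/\ {homo m : x y / x <= y}, forall x y, m y - m x <= d &
      forall t, N t -> exists2 e : R, 0 < e & forall s r,
        s <= t -> t <= r -> r - s < e -> r - s <= m r - m s].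

Lemma null_potentialU N N' :
  null_potential N -> null_potential N' -> null_potential (N `|` N').
Proof.
move=> N0 N'0 d d0; have d20 : 0 < d / 2 by rewrite divr_gt0.
have [m [m_homo md mP]] := N0 _ d20; have [m' [m'_homo m'd m'P]] := N'0 _ d20.
exists (m \+ m'); split => [x y xy|x y|t].
- by rewrite lerD// ?m_homo// m'_homo.
- by have := md x y; have := m'd x y; rewrite /=; lra.
- case=> [/mP|/m'P] [e e0 eP]; exists e => // s r st tr rs;
    have := eP s r st tr rs; have sr := le_trans st tr;
    have := m_homo _ _ sr; have := m'_homo _ _ sr; rewrite /=; lra.
Qed.

Lemma null_potential_shift N h :
  null_potential N -> null_potential [set t | N (t + h)].
Proof.
move=> N0 d d0; have [m [m_homo md mP]] := N0 _ d0.
exists (fun t => m (t + h)); split => [x y xy|x y|t /= /mP[e e0 eP]].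
- by rewrite m_homo// lerD2r.
- exact: md.
- exists e => // s r st tr rs; have := eP (s + h) (r + h).
  have -> : r + h - (s + h) = r - s by ring.
  by rewrite !lerD2r; apply.
Qed.

(** By outer regularity the set lies in an open [U] of measure less than [d]. The function
    [c |-> mu (U & ]-oo, c])] has total increase at most [d] and slope exactly one on intervals
    inside [U]. *)
Lemma negligible_null_potential N :
  (@lebesgue_measure R).-negligible N -> null_potential N.
Proof.
move=> [D [mD D_0 ND]] d d0.
pose mu : {measure set (measurableTypeR R) -> \bar R} := @lebesgue_measure R.
have D0 : mu D = 0%E by exact: D_0.
have Doo : (mu D < +oo)%E by rewrite D0.
have [U [oU DU UD]] := lebesgue_regularity_outer mD Doo d0.
have mU : measurable U by exact: measurable_realfun.open_measurable.
have muU : (mu U < d%:E)%E.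
  have -> : U = D `|` (U `\` D) by rewrite setDUK.
  rewrite measureU//; [|exact: measurableD|by rewrite setDIK].
  by rewrite [X in (X + _)%E]D0 add0e.
have mV c : measurable (U `&` `]-oo, c]%classic).
  by apply: measurableI => //; exact: measurable_itv.
have muV c : (mu (U `&` `]-oo, c]%classic) <= mu U)%E.
  by apply: le_measure; rewrite ?inE; [exact: mV|exact: mU|exact: subIsetl].
have muVf c : mu (U `&` `]-oo, c]%classic) \is a fin_num.
  by rewrite ge0_fin_numE//; apply: le_lt_trans (muV c) (lt_trans muU (ltry _)).
exists (fun c => fine (mu (U `&` `]-oo, c]%classic))); split.
- move=> x y xy; apply: fine_le => //; apply: le_measure; rewrite ?inE; [exact: mV|exact: mV|].
  by apply: setIS => z /=; rewrite !in_itv /= => /le_trans; apply.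
- move=> x y.
  have h1 : 0 <= fine (mu (U `&` `]-oo, x]%classic)) by exact: fine_ge0.
  have h2 : fine (mu (U `&` `]-oo, y]%classic)) <= d.
    rewrite -lee_fin fineK//; apply: le_trans (muV y) (ltW muU).
  lra.
- move=> t /ND /DU Ut.
  have [e /= e0 eU] := (nbhs_ballP _ _).1 (open_nbhs_nbhs (conj oU Ut)).
  exists e => // s r st tr rs.
  have sr : s <= r by exact: le_trans tr.
  have E : U `&` `]-oo, r]%classic = (U `&` `]-oo, s]%classic) `|` `]s, r]%classic.
    apply/seteqP; split => z /=; rewrite !in_itv /=.
      by move=> [Uz zr]; case: (leP z s) => zs; [left|right; rewrite zr].
    move=> [[Uz zs]|/andP[sz zr]]; first by split=> //; exact: le_trans sr.
    split=> //; apply: eU; rewrite -ball_normE /= ltr_norml; apply/andP; split; lra.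
  have Esr : mu `]s, r]%classic = (r - s)%:E.
    rewrite /mu /= lebesgue_measure_itv /= lte_fin.
    case: ltP => // rs'; suff -> : r = s by rewrite subrr.
    by apply/eqP; rewrite eq_le rs' sr.
  have -> : mu (U `&` `]-oo, r]%classic) =
      (mu (U `&` `]-oo, s]%classic) + (r - s)%:E)%E.
    rewrite -Esr E; apply: measureU; [exact: mV|exact: measurable_itv|].
    apply/seteqP; split => z //=; rewrite !in_itv /= => -[[_ zs] /andP[sz _]].
    by move: (lt_le_trans sz zs); rewrite ltxx.
  by rewrite fineD// addrAC subrr add0r.
Qed.

(** Ordered lists of intervals can be concatenated, as the transitivity step of [interval_induction]
    requires, which the indexed disjoint families of [absolutely_continuous] make awkward. *)
Fixpoint chain a l b : Prop :=
  if l is p :: l' then [/\ a <= p.1, p.1 <= p.2 & chain p.2 l' b] else a <= b.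

Definition total_length l := \sum_(p <- l) (p.2 - p.1).

Lemma chain_le a l b : chain a l b -> a <= b.
Proof.
elim: l a => [//|p l IH] a /= [ap pp /IH]; lra.
Qed.

Lemma chain_weaken a' a l b : a' <= a -> chain a l b -> chain a' l b.
Proof.
case: l => [|p l] aa' /=; first exact: le_trans.
by move=> [ap pp pl]; split=> //; exact: le_trans ap.
Qed.

Lemma chain_cat a l b l' c : chain a l b -> chain b l' c -> chain a (l ++ l') c.
Proof.
elim: l a => [|p l IH] a /=; first by move=> ab; exact: chain_weaken.
by move=> [ap pp /IH h] /h.
Qed.

Lemma chain_nth a l b i x0 : chain a l b -> (i < size l)%N ->
  [/\ a <= (nth x0 l i).1, (nth x0 l i).1 <= (nth x0 l i).2 & (nth x0 l i).2 <= b].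
Proof.
elim: l a i => [//|p l IH] a [|i] /= [ap pp pl] il.
  by split=> //; exact: chain_le pl.
by have [h1 h2 h3] := IH _ _ pl il; split => //; lra.
Qed.

Lemma chain_nth_lt a l b i j x0 : chain a l b -> (i < j)%N -> (j < size l)%N ->
  (nth x0 l i).2 <= (nth x0 l j).1.
Proof.
elim: l a i j => [//|p l IH] a [|i] [|j] //= [ap pp pl] ij jl.
  by have [] := chain_nth x0 pl jl.
exact: (IH _ i j pl ij jl).
Qed.

Lemma absolutely_continuous_chain {X : normedModType R} a b (f : R -> X) :
  absolutely_continuous a b f -> forall e : R, 0 < e -> exists2 d : R, 0 < d &
    forall l, chain a l b -> total_length l < d ->
      \sum_(p <- l) `|f p.2 - f p.1| < e.
Proof.
move=> f_ac e e0; have [d d0 dP] := f_ac e e0; exists d => // l al.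
rewrite /total_length !(big_nth (0, 0)) !big_mkord.
pose s (i : 'I_(size l)) := (nth (0, 0) l i).1.
pose t (i : 'I_(size l)) := (nth (0, 0) l i).2.
apply: (dP _ s t) => [i|].
  by have [] := chain_nth (0, 0) al (ltn_ord i).
have st (i j : 'I_(size l)) z : (i < j)%N ->
    `]s i, t i[%classic z -> `]s j, t j[%classic z -> i = j.
  move=> ij; rewrite /= !in_itv /= => /andP[_ zt] /andP[sz _].
  have : t i <= s j by exact: chain_nth_lt al ij _.
  by rewrite leNgt (lt_trans sz zt).
move=> i j _ _ [z [zi zj]]; case: (ltngtP i j) => ij.
- exact: st zi zj.
- by apply/esym; exact: st zj zi.
- exact: val_inj.
Qed.

(** Interval induction keeps the intervals around exceptional points in a list [l], whose total
    length is controlled by [m], so that lower absolute continuity bounds their contribution below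
    by [- e]. The other intervals lose at most [e] times their length. The hypothesis at a good
    point is a nonnegative lower derivative multiplied by [(t' - t)^2], which treats both sides of
    [t] at once. *)
Lemma lower_absolutely_continuous_le (g : R -> R) a b N : a <= b ->
  null_potential N ->
  (forall e : R, 0 < e -> exists2 d : R, 0 < d & forall l,
    chain a l b -> total_length l < d -> - e <= \sum_(p <- l) (g p.2 - g p.1)) ->
  (forall t, a <= t -> t <= b -> ~ N t -> forall e : R, 0 < e ->
    exists2 d : R, 0 < d & forall t', a <= t' -> t' <= b -> `|t' - t| < d ->
      - e * (t' - t) ^+ 2 <= (t' - t) * (g t' - g t)) ->
  g a <= g b.
Proof.
move=> ab N0 g_ac g_good.
have main (e : R) : 0 < e -> - e * (b - a + 1) <= g b - g a.
  move=> e0; have [d d0 dP] := g_ac e e0.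
  have d20 : 0 < d / 2 by rewrite divr_gt0.
  have [m [m_homo md mP]] := N0 _ d20.
  have [l [al lm gl]] : exists l, [/\ chain a l b, total_length l <= m b - m a &
      - e * (b - a) + \sum_(p <- l) (g p.2 - g p.1) <= g b - g a].
    apply: (interval_induction (P := fun s t => exists l,
      [/\ chain s l t, total_length l <= m t - m s &
      - e * (t - s) + \sum_(p <- l) (g p.2 - g p.1) <= g t - g s])) => //.
      move=> s t r _ _ _ _ [l [sl lm gl]] [l' [sl' lm' gl']].
      exists (l ++ l'); split; first exact: chain_cat sl sl'.
        by rewrite /total_length big_cat /= -!/(total_length _); lra.
      by rewrite big_cat /=; lra.
    move=> t at_ tb; have [Nt|Nt] := pselect (N t).
      have [r r0 rP] := mP t Nt; exists r => // u v au ut tv vb uv.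
      exists [:: (u, v)]; split => //=.
      - by split=> //; exact: le_trans ut tv.
      - by rewrite /total_length big_seq1; exact: rP.
      - rewrite big_seq1 /= gerDr mulNr oppr_le0 mulr_ge0//; lra.
    have [r r0 rP] := g_good t at_ tb Nt e e0; exists r => // u v au ut tv vb uv.
    exists [::]; split => /=; first exact: le_trans tv.
      by rewrite /total_length big_nil subr_ge0 m_homo//; exact: le_trans tv.
    have hu : - e * (t - u) <= g t - g u.
      have := rP u au (le_trans ut tb); rewrite ler0_norm; last lra.
      move: ut; rewrite le_eqVlt => /predU1P[-> _|ut]; first by rewrite !subrr mulr0.
      have tu : 0 < t - u by lra.
      by move=> /(_ _) h; rewrite -(ler_pM2l tu); have := h ltac:(lra); lra.
    have hv : - e * (v - t) <= g v - g t.
      have := rP v (le_trans at_ tv) vb; rewrite ger0_norm; last lra.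
      move: tv; rewrite le_eqVlt => /predU1P[-> _|tv]; first by rewrite !subrr mulr0.
      have tu : 0 < v - t by lra.
      by move=> /(_ _) h; rewrite -(ler_pM2l tu); have := h ltac:(lra); lra.
    by rewrite big_nil; lra.
  have := dP l al (le_lt_trans (le_trans lm (md a b)) _).
  by move=> /(_ ltac:(lra)); lra.
rewrite leNgt; apply/negP => gba.
have c0 : 0 < b - a + 1 by lra.
have := main ((g a - g b) / (2 * (b - a + 1))).
rewrite divr_gt0//; [|lra|lra]; move=> /(_ isT).
have -> : - ((g a - g b) / (2 * (b - a + 1))) * (b - a + 1) = - ((g a - g b) / 2).
  by field; rewrite gt_eqF.
lra.
Qed.

End interval_functions.

(** * Derivatives *)

Section vector_derivatives.
Context {R : realType} {X : normedModType R}.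

(** The division-free form allows [t' = t] and fits intervals around [t] in [interval_induction]. *)
Definition has_derivative (f : R -> X) (t : R) (d : X) := forall e : R, 0 < e ->
  exists2 r : R, 0 < r & forall t', `|t' - t| < r ->
    `|f t' - f t - (t' - t) *: d| <= e * `|t' - t|.

Lemma derivable_has_derivative (f : R -> X) t :
  derivable f t 1 -> has_derivative f t (derive1 f t).
Proof.
move=> ft e e0; rewrite derive1E.
have /cvgrPdist_lt /(_ e e0) : (h^-1 *: ((f \o shift t) (h *: 1) - f t)) @[h --> 0^']
  --> 'D_1 f t by exact: ft.
rewrite near_withinE => /nbhs_ballP[r /= r0 rP].
exists r => // t' t'r.
have [->|tt'] := eqVneq t' t; first by rewrite !subrr scale0r subrr !normr0 mulr0.
have := rP (t' - t); rewrite -ball_normE /= sub0r normrN => /(_ t'r).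
rewrite subr_eq0 => /(_ tt').
have -> : (t' - t) *: 1 + t = t' by rewrite /GRing.scale /= mulr1 subrK.
move=> /ltW h.
have -> : f t' - f t - (t' - t) *: 'D_1 f t =
    - ((t' - t) *: ('D_1 f t - (t' - t)^-1 *: (f t' - f t))).
  by rewrite scalerBr scalerA mulfV ?subr_eq0// scale1r opprB.
by rewrite normrN normrZ mulrC ler_wpM2r.
Qed.

(** The reference slope [c] is free: [c = 0] yields Lipschitz bounds, and [c] equal to the
    derivative at an endpoint yields Taylor remainders. *)
Lemma mean_value_le (f D : R -> X) (a b : R) (c : X) (B : R) : a <= b ->
  (forall t, a <= t -> t <= b -> has_derivative f t (D t)) ->
  (forall t, a <= t -> t <= b -> `|D t - c| <= B) ->
  `|f b - f a - (b - a) *: c| <= B * (b - a).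
Proof.
move=> ab fD DB; have ba : 0 <= b - a by rewrite subr_ge0.
have main (e : R) : 0 < e -> `|f b - f a - (b - a) *: c| <= (B + e) * (b - a).
  move=> e0.
  apply: (interval_induction
    (P := fun s t => `|f t - f s - (t - s) *: c| <= (B + e) * (t - s))) => //.
    move=> s t r _ _ _ _ st tr.
    have -> : f r - f s - (r - s) *: c =
        (f t - f s - (t - s) *: c) + (f r - f t - (r - t) *: c).
      have -> : r - s = (t - s) + (r - t) by ring.
      have -> : f r - f s = (f t - f s) + (f r - f t) by rewrite [RHS]addrC subrKA.
      by rewrite scalerDl opprD addrACA.
    by apply: le_trans (ler_normD _ _) _; lra.
  have step t t' : `|D t - c| <= B ->
      `|f t' - f t - (t' - t) *: D t| <= e * `|t' - t| ->
      `|f t' - f t - (t' - t) *: c| <= (B + e) * `|t' - t|.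
    move=> hB he; have -> : f t' - f t - (t' - t) *: c =
        (f t' - f t - (t' - t) *: D t) + (t' - t) *: (D t - c).
      by rewrite scalerBr addrA subrK.
    apply: le_trans (ler_normD _ _) _; rewrite normrZ.
    have : `|t' - t| * `|D t - c| <= `|t' - t| * B by rewrite ler_wpM2l.
    lra.
  move=> t at_ tb; have [r r0 rP] := fD t at_ tb e e0.
  exists r => // u v au ut tv vb uv.
  have hv : `|f v - f t - (v - t) *: c| <= (B + e) * (v - t).
    rewrite -[X in _ * X]ger0_norm ?subr_ge0//; apply: step; first exact: DB.
    by apply: rP; rewrite ger0_norm; lra.
  have hu : `|f t - f u - (t - u) *: c| <= (B + e) * (t - u).
    rewrite -[X in _ * X]ger0_norm ?subr_ge0// [`|t - u|]distrC.
    have -> : f t - f u - (t - u) *: c = - (f u - f t - (u - t) *: c).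
      by rewrite [RHS]opprB -(opprB t u) scaleNr [in RHS]opprB [RHS]addrC.
    rewrite normrN; apply: step; first exact: DB.
    by apply: rP; rewrite ler0_norm; lra.
  have -> : f v - f u - (v - u) *: c =
      (f t - f u - (t - u) *: c) + (f v - f t - (v - t) *: c).
    have -> : v - u = (t - u) + (v - t) by ring.
    have -> : f v - f u = (f t - f u) + (f v - f t) by rewrite [RHS]addrC subrKA.
    by rewrite scalerDl opprD addrACA.
  by apply: le_trans (ler_normD _ _) _; lra.
apply/ler_addgt0Pr => e e0.
have c0 : 0 < b - a + 1 by lra.
apply: le_trans (main _ (divr_gt0 e0 c0)) _.
rewrite mulrDl lerD2l -[leRHS](divfK (lt0r_neq0 c0)) ler_wpM2l//; last lra.
by rewrite divr_ge0// ltW.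
Qed.

Lemma has_derivativeB (f g : R -> X) t df dg :
  has_derivative f t df -> has_derivative g t dg ->
  has_derivative (fun u => f u - g u) t (df - dg).
Proof.
move=> fd gd e e0; have e20 : 0 < e / 2 by rewrite divr_gt0.
have [r r0 rP] := fd _ e20; have [r' r'0 r'P] := gd _ e20.
exists (Num.min r r'); first by rewrite lt_min r0.
move=> t'; rewrite lt_min => /andP[/rP h1 /r'P h2].
have -> : f t' - g t' - (f t - g t) - (t' - t) *: (df - dg) =
    (f t' - f t - (t' - t) *: df) - (g t' - g t - (t' - t) *: dg).
  by rewrite scalerBr !opprD !opprK (addrACA (f t') (- g t')) [LHS]addrACA.
by apply: le_trans (ler_normB _ _) _; lra.
Qed.

Lemma has_derivative_shift (f : R -> X) h t d :
  has_derivative f (t + h) d -> has_derivative (fun u => f (u + h)) t d.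
Proof.
move=> fd e e0; have [r r0 rP] := fd e e0; exists r => // t' tr.
have E : t' + h - (t + h) = t' - t by ring.
by have := rP (t' + h); rewrite E; apply.
Qed.

Lemma has_derivative_cst (c : X) t : has_derivative (fun=> c) t 0.
Proof.
move=> e e0; exists 1 => // t' _.
by rewrite subrr scaler0 subrr normr0 mulr_ge0// ltW.
Qed.

End vector_derivatives.

(** * Convexity of the squared norm along a curve *)

Section chain_continuity.
Context {R : realType} {X : normedModType R}.
Implicit Types (a b : R) (f : R -> X).

Definition chain_ac a b f := forall e : R, 0 < e -> exists2 d : R, 0 < d &
  forall l, chain a l b -> total_length l < d ->
    \sum_(p <- l) `|f p.2 - f p.1| < e.

Lemma chain_ac_bounded a b f : a <= b -> chain_ac a b f ->
  exists2 K : R, 0 < K & forall t, a <= t -> t <= b -> `|f t| <= K.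
Proof.
move=> ab f_ac; have [d d0 dP] := f_ac 1 ltr01.
have close t t' : a <= t -> t <= t' -> t' <= b -> t' - t < d -> `|f t' - f t| < 1.
  move=> at_ tt' tb td; have := dP [:: (t, t')].
  by rewrite /total_length !big_seq1 /=; apply.
suff [K KP] : exists K, forall t, a <= t -> t <= b -> `|f t| <= K.
  by exists (`|K| + 1) => [|t at_ tb]; [rewrite ltr_wpDl|
    rewrite (le_trans (KP t at_ tb))// (le_trans (ler_norm K))// lerDl].
apply: (interval_induction
  (P := fun s t => exists K, forall u, s <= u -> u <= t -> `|f u| <= K)) => //.
  move=> s t r _ _ _ _ [K KP] [K' K'P]; exists (Num.max K K') => u su ur.
  by rewrite le_max; case: (leP u t) => [ut|/ltW tu]; [rewrite KP|rewrite K'P ?orbT].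
move=> t at_ tb; exists d => // s r as_ st tr rb rs.
exists (`|f t| + 1) => u su ur.
have : `|f u - f t| < 1.
  case: (leP t u) => [tu|/ltW ut]; last rewrite distrC; apply: close => //; lra.
by have := lerB_dist (f u) (f t); lra.
Qed.

Lemma chain_ac_shift h a b f : chain_ac (a + h) (b + h) f ->
  chain_ac a b (fun t => f (t + h)).
Proof.
move=> f_ac e e0; have [d d0 dP] := f_ac e e0; exists d => // l al.
pose sh (p : R * R) := (p.1 + h, p.2 + h).
have -> : total_length l = total_length (map sh l).
  by rewrite /total_length big_map; apply: eq_bigr => p _ /=; ring.
have -> : \sum_(p <- l) `|f (p.2 + h) - f (p.1 + h)| =
    \sum_(p <- map sh l) `|f p.2 - f p.1| by rewrite big_map.
apply: dP; move: al {f_ac}; elim: l a => [|p l IH] a' /=; first by rewrite lerD2r.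
by move=> [ap pp /IH pl]; rewrite !lerD2r.
Qed.

Lemma chain_acB a b f g : chain_ac a b f -> chain_ac a b g ->
  chain_ac a b (fun t => f t - g t).
Proof.
move=> f_ac g_ac e e0; have e20 : 0 < e / 2 by rewrite divr_gt0.
have [d d0 dP] := f_ac _ e20; have [d' d'0 d'P] := g_ac _ e20.
exists (Num.min d d'); first by rewrite lt_min d0.
move=> l al; rewrite lt_min => /andP[/(dP _ al) h1 /(d'P _ al) h2].
apply: (@le_lt_trans _ _ (\sum_(p <- l) (`|f p.2 - f p.1| + `|g p.2 - g p.1|))).
  apply: ler_sum => p _.
  have -> : f p.2 - g p.2 - (f p.1 - g p.1) = (f p.2 - f p.1) - (g p.2 - g p.1).
    by rewrite !opprD !opprK addrACA.
  exact: ler_normB.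
by rewrite big_split /=; lra.
Qed.

Lemma chain_mem a l b p : chain a l b -> p \in l ->
  [/\ a <= p.1, p.1 <= p.2 & p.2 <= b].
Proof.
by move=> al /(nthP (0, 0))[i il <-]; exact: chain_nth al il.
Qed.

(** Serves [psi_increment], whose bound involves an intermediate point of each interval: absolute
    continuity is applied a second time, to the shortened intervals. *)
Lemma chain_retract a l b (u : R * R -> R) :
  (forall p, p.1 <= p.2 -> p.1 <= u p <= p.2) -> chain a l b ->
  let l' := [seq (p.1, u p) | p <- l] in
  chain a l' b /\ total_length l' <= total_length l.
Proof.
move=> uP; rewrite /total_length big_map /=.
elim: l a => [|p l IH] a /=; first by rewrite !big_nil.
move=> [ap pp pl]; have /andP[pu up] := uP p pp.
have [pl' sl] := IH _ pl; rewrite !big_cons; split; last by rewrite /= in sl *; lra.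
by split => //; exact: chain_weaken pl'.
Qed.

End chain_continuity.

(** When [D] is the derivative of [z], this is half the derivative of [|z|^2], as
    [has_derivative_sqr_norm] shows. *)
Definition pairing {R : realType} {X : normedModType R} (z D : R -> X) (t : R) :=
  J (z t) (D t).

(** * Energy inequality for the pairing of a curve with its derivative *)

Section energy.
Context {R : realType} {X : normedModType R} (M : R).
Hypotheses (M0 : 0 < M) (J_mono : strongly_monotone_duality X M).
Hypothesis smooth : uniformly_smooth X.
Variables (z D : R -> X) (N : set R) (a b : R).
Hypotheses (ab : a <= b) (N0 : null_potential N).
Hypothesis z_der : forall t, a <= t -> t <= b -> has_derivative z t (D t).
Hypothesis D_ac : chain_ac a b D.
Hypothesis D_der : forall t, a <= t -> t <= b -> ~ N t ->
  exists2 w, has_derivative D t w & 0 <= J (z t) w.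

Local Notation psi := (pairing z D).

Let J_fun x := @J_scalar _ X x.

Lemma curve_bounded :
  exists2 K : R, 0 < K & forall t, a <= t -> t <= b -> `|z t| <= K.
Proof.
have [L L0 LP] := chain_ac_bounded ab D_ac.
exists (`|z a| + L * (b - a) + 1).
  by rewrite ltr_wpDl// addr_ge0// mulr_ge0// ?(ltW L0)// subr_ge0.
move=> t at_ tb.
have : `|z t - z a - (t - a) *: 0| <= L * (t - a).
  apply: (mean_value_le (D := D)) => // s as_ st; first by apply: z_der => //; lra.
  by rewrite subr0; apply: LP => //; lra.
rewrite scaler0 subr0 => h1.
have h2 : L * (t - a) <= L * (b - a) by rewrite ler_wpM2l ?(ltW L0)//; lra.
by have := lerB_dist (z t) (z a); lra.
Qed.

(* The strong monotonicity of J makes the second term of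
   psi r - psi s = J (z r) (D r - D s) + (J (z r) - J (z s)) (D s)
   nonnegative up to the error made in replacing D s by a difference quotient
   of z. *)
Lemma psi_increment (K s r : R) : (forall t, a <= t -> t <= b -> `|z t| <= K) ->
  a <= s -> s <= r -> r <= b -> exists u, s <= u <= r /\
    - K * `|D r - D s| - 4 * K * `|D u - D s| <= psi r - psi s.
Proof.
move=> zK as_ sr rb.
have K0 : 0 <= K by apply: le_trans (zK s as_ _) => //; exact: le_trans rb.
have zs : `|z s| <= K by apply: zK => //; exact: le_trans rb.
have zr : `|z r| <= K by apply: zK => //; exact: le_trans sr.
move: (sr); rewrite le_eqVlt => /predU1P[<-|sr'].
  by exists s; rewrite lexx !subrr normr0 !mulr0 subr0.
have d0 : 0 < r - s by rewrite subr_gt0.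
set E := z r - z s - (r - s) *: D s.
(* A point where the mean value bound on [E] is attained up to a factor 2; if there were none,
   [mean_value_le] would give [|E| <= |E| / 2]. *)
have [u [su EU]] : exists u, s <= u <= r /\ `|E| <= 2 * (r - s) * `|D u - D s|.
  have [E0|E0] := eqVneq `|E| 0.
    by exists s; rewrite lexx sr E0 subrr normr0 mulr0.
  apply: contrapT => /forallNP noU.
  have B0 : 0 < `|E| by rewrite lt0r E0 normr_ge0.
  have : `|E| <= `|E| / (2 * (r - s)) * (r - s).
    apply: (mean_value_le (D := D)) => // t st tr; first by apply: z_der; lra.
    have /not_andP[|] := noU t; first by rewrite st tr.
    move=> /negP; rewrite -ltNge => /ltW h.
    by rewrite ler_pdivlMr ?mulr_gt0//; lra.
  have -> : `|E| / (2 * (r - s)) * (r - s) = `|E| / 2 by field; rewrite gt_eqF.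
  lra.
exists u; split => //.
have Er : (r - s) *: D s = (z r - z s) - E by rewrite subKr.
have h1 := J_ge M0 J_mono (z r) (D r - D s).
have h2 : - (2 * K * `|E|) <= (r - s) * (J (z r) (D s) - J (z s) (D s)).
  rewrite mulrBr -!(scalar_funZ (J_fun _)) Er.
  rewrite (scalar_funB (J_fun (z r)) (z r - z s)) (scalar_funB (J_fun (z s)) (z r - z s)).
  have := J_monotone J_mono (z r) (z s).
  have := J_le M0 J_mono (z r) E; have := J_ge M0 J_mono (z s) E.
  have : `|z r| * `|E| <= K * `|E| by rewrite ler_wpM2r.
  have : `|z s| * `|E| <= K * `|E| by rewrite ler_wpM2r.
  have : 0 <= M * `|z r - z s| ^+ 2 by rewrite mulr_ge0 ?(ltW M0)// sqr_ge0.
  lra.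
have h3 : - (4 * K * `|D u - D s|) <= J (z r) (D s) - J (z s) (D s).
  rewrite -(ler_pM2l d0); apply: le_trans h2; rewrite mulrN lerN2.
  have : K * `|E| <= K * (2 * (r - s) * `|D u - D s|) by rewrite ler_wpM2l.
  lra.
have h4 : `|z r| * `|D r - D s| <= K * `|D r - D s| by rewrite ler_wpM2r.
move: h1; rewrite (scalar_funB (J_fun (z r))) /pairing; lra.
Qed.

Lemma psi_lower_ac (C : R) (h : R -> R) : 0 <= C ->
  (forall s r, a <= s -> s <= r -> r <= b -> - C * (r - s) <= h r - h s) ->
  forall e : R, 0 < e -> exists2 d : R, 0 < d & forall l,
    chain a l b -> total_length l < d ->
    - e <= \sum_(p <- l) ((psi p.2 + h p.2) - (psi p.1 + h p.1)).
Proof.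
move=> C0 hC e e0.
have [K K0 zK] := curve_bounded.
have /choice[u uP] p : exists u, (p.1 <= p.2 -> p.1 <= u <= p.2) /\
    (a <= p.1 -> p.1 <= p.2 -> p.2 <= b ->
    - K * `|D p.2 - D p.1| - 4 * K * `|D u - D p.1| <= psi p.2 - psi p.1).
  have [[ap [pp pb]]|np] := pselect (a <= p.1 /\ p.1 <= p.2 /\ p.2 <= b).
    by have [u [pu uP]] := psi_increment zK ap pp pb; exists u.
  by exists p.1; split => [->|ap pp pb]; [rewrite lexx|case: np].
(* The weights [K] and [4 K] of [psi_increment] turn [e / (10 K)] into [e / 2]; the other half pays
   for [h]. *)
have e'0 : 0 < e / (10 * K) by rewrite divr_gt0// mulr_gt0.
have [d d0 dP] := D_ac e'0.
have c'0 : 0 < e / (2 * (C + 1)) by rewrite divr_gt0// mulr_gt0// ltr_wpDl.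
exists (Num.min d (e / (2 * (C + 1)))); first by rewrite lt_min d0.
move=> l al; rewrite lt_min => /andP[ld lC].
have [al' ll'] := chain_retract (fun p => (uP p).1) al.
have s1 := dP l al ld.
have := dP _ al' (le_lt_trans ll' ld); rewrite big_map /= => s2.
have Ce : C * total_length l <= e / 2.
  have : total_length l * (C + 1) <= e / (2 * (C + 1)) * (C + 1).
    by rewrite ler_wpM2r ?(ltW lC)// addr_ge0.
  have -> : e / (2 * (C + 1)) * (C + 1) = e / 2.
    by field; rewrite gt_eqF// ltr_wpDl.
  have : 0 <= total_length l.
    rewrite /total_length big_seq sumr_ge0// => p /(chain_mem al)[_ pp _].
    by rewrite subr_ge0.
  lra.
have -> : - e = - K * (e / (10 * K)) - 4 * K * (e / (10 * K)) - e / 2.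
  by field; rewrite gt_eqF.
apply: (@le_trans _ _ (\sum_(p <- l) (- K * `|D p.2 - D p.1|
    - 4 * K * `|D (u p) - D p.1| - C * (p.2 - p.1)))); last first.
  rewrite !big_seq; apply: ler_sum => p /(chain_mem al)[ap pp pb].
  have := (uP p).2 ap pp pb; have := hC _ _ ap pp pb; lra.
rewrite !big_split /= !sumrN -!mulr_sumr -/(total_length l).
have : K * \sum_(p <- l) `|D p.2 - D p.1| <= K * (e / (10 * K)).
  by rewrite ler_wpM2l ?ltW.
have : K * \sum_(p <- l) `|D (u p) - D p.1| <= K * (e / (10 * K)).
  by rewrite ler_wpM2l ?ltW.
lra.
Qed.

(** Formally, [psi'] is [J z z''], which is nonnegative, plus a term at least [M |z'|^2] by strong
    monotonicity. As [2 c f(z') - c^2 <= |z'|^2], adding [h'] keeps the sum nonnegative. The square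
    is thus replaced by the derivative of an explicit function, and no integral of [|z'|^2] has to
    be formed. *)
Lemma psi_local (f : X -> R) (c : R) : scalar f -> (forall k, f k <= `|k|) ->
  let h u := - (M * (2 * c * f (z u) - c ^+ 2 * u)) in
  forall t, a <= t -> t <= b -> ~ N t -> forall e : R, 0 < e ->
    exists2 d : R, 0 < d & forall t', a <= t' -> t' <= b -> `|t' - t| < d ->
      - e * (t' - t) ^+ 2 <= (t' - t) * ((psi t' + h t') - (psi t + h t)).
Proof.
move=> f_lin f_le h t at_ tb Nt e e0.
have [w Dw Jw] := D_der at_ tb Nt.
have [K K0 zK] := curve_bounded.
pose W := `|w| + 1; have W0 : 0 < W by rewrite ltr_wpDl.
(* The cap 1 gives [D] the Lipschitz constant [W] at [t]; the value [e / (2 K)] limits the cost of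
   the remainder [rho] to [e / 2 * dt^2]. *)
pose e2 := Num.min 1 (e / (2 * K)).
have e20 : 0 < e2 by rewrite lt_min ltr01 divr_gt0// mulr_gt0.
have e1_gt0 : 0 < e / (4 * W) by rewrite divr_gt0// mulr_gt0.
have [d1 d10 JP] := J_continuous M0 J_mono smooth (z t) e1_gt0.
have [d2 d20 DP] := Dw _ e20.
have D_lip u : `|u - t| < d2 -> `|D u - D t| <= W * `|u - t|.
  move=> /DP h1; have -> : D u - D t = (D u - D t - (u - t) *: w) + (u - t) *: w.
    by rewrite subrK.
  apply: le_trans (ler_normD _ _) _; rewrite normrZ.
  have : e2 * `|u - t| <= 1 * `|u - t| by rewrite ler_wpM2r// /e2 ge_min lexx.
  rewrite /W; lra.
have [d3 d30 zP] := z_der at_ tb ltr01.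
pose V := `|D t| + 1; have V0 : 0 < V by rewrite ltr_wpDl.
exists (Num.min d2 (Num.min d3 (d1 / V))).
  by rewrite !lt_min d20 d30 divr_gt0.
move=> t' at' tb'; rewrite !lt_min => /and3P[t2 t3 t1].
set dt := t' - t in t1 t2 t3 *.
have z_near : `|z t' - z t| < d1.
  have -> : z t' - z t = (z t' - z t - dt *: D t) + dt *: D t by rewrite subrK.
  apply: le_lt_trans (ler_normD _ _) _; rewrite normrZ.
  by have := zP _ t3; rewrite -/dt; rewrite ltr_pdivlMr// /V in t1; lra.
set rho := D t' - D t - dt *: w.
have rhoP : `|rho| <= e2 * `|dt| by exact: DP.
set sigma := z t' - z t - dt *: D t.
(* Differentiability of [z] alone would give a remainder [o(dt)]; the Lipschitz bound on [D] at [t]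
   makes it quadratic, as an estimate of order [dt^2] requires. *)
have sigmaP : `|sigma| <= W * dt ^+ 2.
  rewrite -[dt ^+ 2]ger0_norm ?sqr_ge0// normrX expr2 mulrA.
  case: (leP t t') => tt'.
    rewrite -[X in _ * X]/(`|dt|) [X in _ * X]ger0_norm ?subr_ge0//.
    apply: (mean_value_le (D := D)) => // u tu ut'; first by apply: z_der; lra.
    have ud : `|u - t| <= `|dt| by rewrite !ger0_norm /dt; lra.
    apply: le_trans (D_lip u (le_lt_trans ud t2)) _.
    by rewrite ler_wpM2l ?(ltW W0).
  have tt := ltW tt'.
  have -> : sigma = - (z t - z t' - (t - t') *: D t).
    by rewrite /sigma [RHS]opprB -(opprB t' t) scaleNr [RHS]addrC opprB.
  rewrite normrN [X in _ * X]distrC [X in _ * X]ger0_norm ?subr_ge0//.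
  apply: (mean_value_le (D := D)) => // u tu ut'; first by apply: z_der; lra.
  have ud : `|u - t| <= `|dt| by rewrite !ler0_norm /dt; lra.
  apply: le_trans (D_lip u (le_lt_trans ud t2)) _.
  by rewrite ler_wpM2l ?(ltW W0).
have dt2 : `|dt| * `|dt| = dt ^+ 2 by rewrite -normrM -expr2 ger0_norm ?sqr_ge0.
have J_near := JP _ z_near.
(* Error budget, in units of [e * dt^2]: 1/4 and 1/2 here, and the last 1/4 in [p2]. *)
have p1 : - (e / 4) * dt ^+ 2 - e / 2 * dt ^+ 2 <= dt * J (z t') (D t' - D t).
  have -> : D t' - D t = dt *: w + rho by rewrite [RHS]addrC subrK.
  rewrite (scalar_funD (J_fun _)) (scalar_funZ (J_fun _)).
  have q1 : - (e / 4) <= J (z t') w.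
    have := J_near w; rewrite ler_norml => /andP[+ _].
    have : e / (4 * W) * `|w| <= e / 4.
      have -> : e / 4 = e / (4 * W) * W by field; rewrite gt_eqF.
      by rewrite ler_wpM2l ?(ltW e1_gt0)// /W lerDl.
    lra.
  have q2 : - (e / 2 * dt ^+ 2) <= dt * J (z t') rho.
    have : `|dt * J (z t') rho| <= `|dt| * (K * (e2 * `|dt|)).
      rewrite normrM ler_wpM2l//; apply: le_trans (J_norm M0 J_mono _ _) _.
      by rewrite ler_pM ?zK.
    rewrite ler_norml => /andP[+ _].
    have -> : `|dt| * (K * (e2 * `|dt|)) = K * e2 * dt ^+ 2 by rewrite -dt2; ring.
    have : K * e2 * dt ^+ 2 <= e / 2 * dt ^+ 2.
      rewrite ler_wpM2r ?sqr_ge0//.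
      have -> : e / 2 = K * (e / (2 * K)) by field; rewrite gt_eqF.
      by rewrite ler_wpM2l ?(ltW K0)// /e2 ge_min lexx orbT.
    lra.
  have : - (e / 4) * dt ^+ 2 <= J (z t') w * dt ^+ 2 by rewrite ler_wpM2r ?sqr_ge0.
  by rewrite mulrDr; lra.
have p2 : M * `|z t' - z t| ^+ 2 - e / 4 * dt ^+ 2 <=
    dt * (J (z t') (D t) - J (z t) (D t)).
  have zE : dt *: D t = (z t' - z t) - sigma by rewrite subKr.
  rewrite mulrBr -!(scalar_funZ (J_fun _)) zE.
  rewrite (scalar_funB (J_fun (z t')) (z t' - z t)).
  rewrite (scalar_funB (J_fun (z t)) (z t' - z t)).
  have := J_monotone J_mono (z t') (z t).
  have := J_near sigma; rewrite ler_norml => /andP[_].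
  have : e / (4 * W) * `|sigma| <= e / (4 * W) * (W * dt ^+ 2).
    by rewrite ler_wpM2l ?(ltW e1_gt0).
  have -> : e / (4 * W) * (W * dt ^+ 2) = e / 4 * dt ^+ 2 by field; rewrite gt_eqF.
  lra.
have p3 : 2 * c * dt * f (z t' - z t) - c ^+ 2 * dt ^+ 2 <= `|z t' - z t| ^+ 2.
  have fle : `|f (z t' - z t)| <= `|z t' - z t|.
    rewrite ler_norml f_le andbT lerNl -(scalar_funN f_lin).
    by apply: le_trans (f_le _) _; rewrite normrN.
  have : c * dt * f (z t' - z t) <= `|c * dt| * `|z t' - z t|.
    by apply: le_trans (ler_norm _) _; rewrite normrM ler_wpM2l.
  have := sqr_ge0 (`|c * dt| - `|z t' - z t|).
  have : `|c * dt| ^+ 2 = c ^+ 2 * dt ^+ 2.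
    by rewrite -normrX ger0_norm ?sqr_ge0// exprMn.
  rewrite sqrrB; lra.
have p3M : M * (2 * c * dt * f (z t' - z t) - c ^+ 2 * dt ^+ 2) <=
    M * `|z t' - z t| ^+ 2 by rewrite ler_wpM2l ?(ltW M0).
have -> : dt * (psi t' + h t' - (psi t + h t)) = dt * J (z t') (D t' - D t) +
    dt * (J (z t') (D t) - J (z t) (D t)) -
    M * (2 * c * dt * f (z t' - z t) - c ^+ 2 * dt ^+ 2).
  rewrite (scalar_funB (J_fun (z t'))) (scalar_funB f_lin) /pairing /h /dt; ring.
lra.
Qed.

Lemma psi_energy (f : X -> R) (c : R) : scalar f -> (forall k, f k <= `|k|) ->
  M * (2 * c * (f (z b) - f (z a)) - c ^+ 2 * (b - a)) <= psi b - psi a.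
Proof.
move=> f_lin f_le; pose h u := - (M * (2 * c * f (z u) - c ^+ 2 * u)).
suff : psi a + h a <= psi b + h b by rewrite /h; lra.
have [L L0 LP] := chain_ac_bounded ab D_ac.
apply: (lower_absolutely_continuous_le (g := fun u => psi u + h u) ab N0); last first.
  exact: psi_local.
apply: (psi_lower_ac (C := M * (2 * `|c| * L))).
  by rewrite !mulr_ge0// ltW.
move=> s r as_ sr rb; rewrite /h.
have zL : `|z r - z s| <= L * (r - s).
  have : `|z r - z s - (r - s) *: 0| <= L * (r - s).
    apply: (mean_value_le (D := D)) => // t st tr; first by apply: z_der; lra.
    by rewrite subr0; apply: LP; lra.
  by rewrite scaler0 subr0.
have fle : `|f (z r - z s)| <= L * (r - s).
  rewrite ler_norml (le_trans (f_le _) zL) andbT lerNl -(scalar_funN f_lin).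
  by apply: le_trans (f_le _) _; rewrite normrN.
have : c * f (z r - z s) <= `|c| * (L * (r - s)).
  by apply: le_trans (ler_norm _) _; rewrite normrM ler_wpM2l.
have : 0 <= c ^+ 2 * (r - s) by rewrite mulr_ge0 ?sqr_ge0// subr_ge0.
rewrite (scalar_funB f_lin) => h1 h2.
have : M * (2 * (c * (f (z r) - f (z s))) - c ^+ 2 * (r - s)) <=
  M * (2 * (`|c| * (L * (r - s)))) by rewrite ler_wpM2l ?(ltW M0)//; lra.
lra.
Qed.

(* Optimal choice in psi_energy: f = J d / |d| with d = z b - z a, and
   c = |d| / (b - a). *)
Lemma psi_energy_sqr :
  M * `|z b - z a| ^+ 2 <= (psi b - psi a) * (b - a).
Proof.
move: ab; rewrite le_eqVlt => /predU1P[<-|ab'].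
  by rewrite !subrr normr0 expr0n !mulr0.
have ba : 0 < b - a by rewrite subr_gt0.
set d := z b - z a.
have [d_0|d_0] := eqVneq d 0.
  rewrite d_0 normr0 expr0n mulr0 mulr_ge0 ?(ltW ba)//.
  have := @psi_energy (fun=> 0) 0 _ _; rewrite expr0n !(mulr0, mul0r, subrr).
  by apply=> [? ? ?|k]; rewrite ?mulr0 ?addr0.
have nd : 0 < `|d| by rewrite normr_gt0.
have := @psi_energy (fun k => `|d|^-1 * J d k) (`|d| / (b - a)).
have f_lin : scalar (fun k : X => `|d|^-1 * J d k).
  move=> x u v; rewrite (scalar_funD (J_fun d)) (scalar_funZ (J_fun d)).
  by rewrite mulrDr mulrCA.
have f_le k : `|d|^-1 * J d k <= `|k|.
  by rewrite mulrC ler_pdivrMr// mulrC; exact: (J_le M0 J_mono).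
move=> /(_ f_lin f_le).
rewrite -mulrBr -(scalar_funB (J_fun d)) -/d (J_self M0 J_mono) -ler_pdivrMr//.
have -> : M * (2 * (`|d| / (b - a)) * (`|d|^-1 * `|d| ^+ 2) -
    (`|d| / (b - a)) ^+ 2 * (b - a)) = M * `|d| ^+ 2 / (b - a).
  by field; rewrite !gt_eqF.
by [].
Qed.

End energy.

(** * Derivative and convexity of the squared norm *)

Section square_norm.
Context {R : realType} {X : normedModType R} (M : R).
Hypotheses (M0 : 0 < M) (J_mono : strongly_monotone_duality X M).
Hypothesis smooth : uniformly_smooth X.
Variables (z D : R -> X).

Local Notation psi := (pairing z D).

(** The subgradient inequalities at [z t] and at [z t'] squeeze the increment of [|z|^2] between
    [2 J (z t) (z t' - z t)] and [2 J (z t') (z t' - z t)], which [J_continuous] brings together. *)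
Lemma has_derivative_sqr_norm t : has_derivative z t (D t) ->
  has_derivative (fun u => `|z u| ^+ 2 : R^o) t (2 * psi t).
Proof.
move=> zD e e0.
pose K := `|z t| + 1; have K0 : 0 < K by rewrite ltr_wpDl.
pose V := `|D t| + 1; have V0 : 0 < V by rewrite ltr_wpDl.
have e1_gt0 : 0 < e / (4 * V) by rewrite divr_gt0// mulr_gt0.
have e2_gt0 : 0 < e / (4 * K) by rewrite divr_gt0// mulr_gt0.
have [d1 d10 JP] := J_continuous M0 J_mono smooth (z t) e1_gt0.
have [d2 d20 zP1] := zD 1 ltr01.
have [d3 d30 zP2] := zD _ e2_gt0.
exists (Num.min d2 (Num.min d3 (d1 / V))).
  by rewrite !lt_min d20 d30 divr_gt0.
move=> t'; rewrite !lt_min => /and3P[t2 t3 t1].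
set dt := t' - t in t1 t2 t3 *; set sigma := z t' - z t - dt *: D t.
have zE : z t' - z t = dt *: D t + sigma by rewrite [RHS]addrC subrK.
have z_lip : `|z t' - z t| <= V * `|dt|.
  rewrite zE; apply: le_trans (ler_normD _ _) _; rewrite normrZ.
  by have := zP1 _ t2; rewrite -/dt -/sigma /V; lra.
have z_near : `|z t' - z t| < d1.
  by apply: le_lt_trans z_lip _; rewrite mulrC -ltr_pdivlMr.
have sigmaP : `|2 * J (z t) sigma| <= e / 2 * `|dt|.
  rewrite normrM ger0_norm//.
  have : `|z t| * `|sigma| <= K * (e / (4 * K) * `|dt|).
    by rewrite ler_pM// ?zP2// /K lerDl.
  have -> : K * (e / (4 * K) * `|dt|) = e / 4 * `|dt| by field; rewrite gt_eqF.
  have := J_norm M0 J_mono (z t) sigma; lra.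
have JJ : `|J (z t') (z t' - z t) - J (z t) (z t' - z t)| <= e / 4 * `|dt|.
  apply: le_trans (JP _ z_near _) _.
  have -> : e / 4 * `|dt| = e / (4 * V) * (V * `|dt|) by field; rewrite gt_eqF.
  by rewrite ler_wpM2l// ltW.
have Jz : J (z t) (z t' - z t) = dt * psi t + J (z t) sigma.
  by rewrite zE (scalar_funD (@J_scalar _ _ _)) (scalar_funZ (@J_scalar _ _ _)).
have h1 := J_subgradient M0 J_mono (z t) (z t').
have := J_subgradient M0 J_mono (z t') (z t).
rewrite -(opprB (z t')) (scalar_funN (@J_scalar _ _ _)) => h2.
move: sigmaP JJ; rewrite !ler_norml => /andP[s1 s2] /andP[j1 j2].
rewrite /GRing.scale /=; apply/andP; split; lra.
Qed.

(* phi' = 2 psi and psi is nondecreasing, so phi is convex. *)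
Lemma sqr_norm_convex a b : a <= b ->
  (forall t, a <= t -> t <= b -> has_derivative z t (D t)) ->
  (forall t, a <= t -> t <= b -> psi a <= psi t /\ psi t <= psi b) ->
  2 * psi a * (b - a) <= `|z b| ^+ 2 - `|z a| ^+ 2 /\
  `|z b| ^+ 2 - `|z a| ^+ 2 <= 2 * psi b * (b - a).
Proof.
move=> ab zD psiP.
(* The slopes [2 psi t] lie within [psi b - psi a] of [psi a + psi b], the middle of [2 psi a] and
   [2 psi b]; one application then gives both bounds. *)
have := @mean_value_le R R^o (fun u => `|z u| ^+ 2) (fun u => 2 * psi u) a b
  (psi a + psi b) (psi b - psi a) ab.
move=> /(_ (fun t at_ tb => has_derivative_sqr_norm (zD t at_ tb))).
have h t : a <= t -> t <= b -> `|2 * psi t - (psi a + psi b)| <= psi b - psi a.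
  move=> at_ tb; have [] := psiP t at_ tb.
  by rewrite ler_norml => ? ?; apply/andP; split; lra.
move=> /(_ h); rewrite ler_norml => /andP[h1 h2].
rewrite /GRing.scale /= in h1 h2; split; lra.
Qed.

End square_norm.

(** * Solutions of the incomplete Cauchy problem *)

Section flow.
Context {R : realType} {X : normedModType R} (M : R).
Hypotheses (M0 : 0 < M) (J_mono : strongly_monotone_duality X M).
Hypothesis smooth : uniformly_smooth X.
Variables (z D : R -> X) (N : set R).
Hypothesis N0 : null_potential N.
Hypothesis z_der : forall t, 0 < t -> has_derivative z t (D t).
Hypothesis D_ac : forall a b, 0 < a -> a < b -> chain_ac a b D.
Hypothesis D_der : forall t, 0 < t -> ~ N t ->
  exists2 w, has_derivative D t w & 0 <= J (z t) w.

Local Notation psi := (pairing z D).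

Lemma flow_energy a b : 0 < a -> a < b ->
  M * `|z b - z a| ^+ 2 <= (psi b - psi a) * (b - a).
Proof.
move=> a0 ab; apply: (psi_energy_sqr M0 J_mono smooth (ltW ab) N0).
- by move=> t at_ _; apply: z_der; exact: lt_le_trans at_.
- exact: D_ac.
- by move=> t at_ _; apply: D_der; exact: lt_le_trans at_.
Qed.

Lemma flow_psi_le a b : 0 < a -> a <= b -> psi a <= psi b.
Proof.
move=> a0; rewrite le_eqVlt => /predU1P[->//|ab].
have ba : 0 < b - a by rewrite subr_gt0.
rewrite -subr_ge0 -(pmulr_lge0 _ ba); apply: le_trans (flow_energy a0 ab).
by rewrite mulr_ge0 ?sqr_ge0// ltW.
Qed.

Lemma flow_convex a b : 0 < a -> a <= b ->
  2 * psi a * (b - a) <= `|z b| ^+ 2 - `|z a| ^+ 2 /\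
  `|z b| ^+ 2 - `|z a| ^+ 2 <= 2 * psi b * (b - a).
Proof.
move=> a0 ab; apply: (sqr_norm_convex M0) => // t at_ tb.
  by apply: z_der; exact: lt_le_trans at_.
by split; apply: flow_psi_le => //; exact: lt_le_trans at_.
Qed.

Hypothesis z_bounded : exists K : R, forall t, 0 < t -> `|z t| <= K.

Lemma flow_psi_le0 t : 0 < t -> psi t <= 0.
Proof.
move=> t0; have [K KP] := z_bounded.
rewrite leNgt; apply/negP => p0.
have K0 : 0 <= K by apply: le_trans (KP t t0).
(* Far enough for the tangent at [t] to rise by [K^2 + 1], more than the bound [|z|^2 <= K^2]
   permits. *)
pose b := t + (K ^+ 2 + 1) / (2 * psi t).
have d0 : 0 < (K ^+ 2 + 1) / (2 * psi t).
  by rewrite divr_gt0 ?mulr_gt0// ltr_wpDl// sqr_ge0.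
have tb : t <= b by rewrite lerDl ltW.
have [+ _] := flow_convex t0 tb.
have -> : 2 * psi t * (b - t) = K ^+ 2 + 1.
  by rewrite /b; field; rewrite gt_eqF.
have : `|z b| ^+ 2 <= K ^+ 2.
  by rewrite lerXn2r ?nnegrE// KP//; exact: lt_le_trans tb.
have := sqr_ge0 `|z t|; lra.
Qed.

Lemma flow_norm_le a b : 0 < a -> a <= b -> `|z b| <= `|z a|.
Proof.
move=> a0 ab; have [_ h] := flow_convex a0 ab.
rewrite -(@ler_pXn2r _ 2) ?nnegrE// -subr_le0; apply: le_trans h _.
rewrite mulr_le0_ge0 ?subr_ge0// pmulr_rle0//.
by apply: flow_psi_le0; exact: lt_le_trans ab.
Qed.

(** By convexity [|z|^2] drops by at least [- 2 psi b (b - a)] over [[a, b]], and it cannot drop by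
    more than its value at [a]. *)
Lemma flow_psi_decay a b : 0 < a -> a <= b -> - psi b * (2 * (b - a)) <= `|z a| ^+ 2.
Proof.
move=> a0 ab; have [_] := flow_convex a0 ab; have := sqr_ge0 `|z b|; lra.
Qed.

End flow.

(** * Solutions compared with zeros and with their own time shifts *)

Section orbit.
Context {R : realType} {X : normedModType R} (M : R).
Hypotheses (M0 : 0 < M) (J_mono : strongly_monotone_duality X M).
Hypothesis smooth : uniformly_smooth X.
Variables (A : X -> set X) (x : X) (v : R -> X).
Hypotheses (A_acc : accretive A) (v_sol : incomplete_cauchy_solution A x v).

Let D := derive1 v.
Let N := ~` [set t | 0 < t -> derivable D t 1 /\ A (v t) (derive1n 2 v t)].

Let N0 : null_potential N.
Proof. by apply: negligible_null_potential; case: v_sol. Qed.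

Let v_der t : 0 < t -> has_derivative v t (D t).
Proof. by case: v_sol => _ _ _ [vd _] _ /vd; exact: derivable_has_derivative. Qed.

Let D_ac a b : 0 < a -> a < b -> chain_ac a b D.
Proof.
by case: v_sol => _ _ _ [_ vac] _ a0 ab; exact/absolutely_continuous_chain/vac.
Qed.

Let D_der t : 0 < t -> ~ N t -> exists2 w, has_derivative D t w & A (v t) w.
Proof.
move=> t0 /contrapT /(_ t0)[Dt At]; exists (derive1n 2 v t) => //.
exact: derivable_has_derivative Dt.
Qed.

Let v_bounded : exists2 K : R, 0 <= K & forall t, 0 < t -> `|v t| <= K.
Proof.
case: v_sol => _ _ [K KP] _ _; exists K => [|t t0]; last exact/KP/ltW.
exact: le_trans (KP 0 (lexx _)).
Qed.

Lemma solution_dist_zero p : zeros A p -> forall t, 0 <= t -> `|v t - p| <= `|x - p|.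
Proof.
move=> Ap t; have vx : v 0 = x by case: v_sol.
rewrite le_eqVlt => /predU1P[<-|t0]; first by rewrite vx.
have norm_le s : 0 < s -> s <= t -> `|v t - p| <= `|v s - p|.
  move=> s0 st.
  apply: (@flow_norm_le _ _ _ M0 J_mono smooth (fun u => v u - p) D _ N0) => //.
  - by move=> u u0; rewrite -[D u]subr0; apply: has_derivativeB;
      [exact: v_der|exact: has_derivative_cst].
  - move=> u u0 /(D_der u0)[w Dw Aw]; exists w => //.
    by have := A_acc Aw Ap; rewrite subr0.
  - have [K K0 KP] := v_bounded; exists (K + `|p|) => u u0.
    by apply: le_trans (ler_normB _ _) _; rewrite lerD2r; exact: KP.
(* The flow estimates concern positive times only; continuity of [v] at 0 extends them to the
   initial value. *)
apply/ler_addgt0Pr => e e0.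
have v_cont : {within `[0, +oo[, continuous v} by case: v_sol.
have /subspace_continuousP /(_ 0) := v_cont.
rewrite /= in_itv /= lexx => /(_ isT) /cvgrPdist_lt /(_ e e0).
rewrite near_withinE => /nbhs_ballP[r /= r0 rP].
pose s := Num.min t (r / 2).
have s0 : 0 < s by rewrite lt_min t0 divr_gt0.
have st : s <= t by rewrite ge_min lexx.
have sr : s <= r / 2 by rewrite ge_min lexx orbT.
have := rP s; rewrite -ball_normE /= sub0r normrN gtr0_norm// in_itv /= (ltW s0).
move=> /(_ ltac:(lra) isT). rewrite /from_subspace vx => h.
apply: le_trans (norm_le s s0 st) _.
by have := ler_distD x (v s) p; rewrite [`|v s - x|]distrC; lra.
Qed.

Let z (h t : R) : X := v (t + h) - v t.
Let Dz (h t : R) : X := D (t + h) - D t.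
Let Nz (h : R) := [set t | N (t + h)] `|` N.

Let Nz0 h : null_potential (Nz h).
Proof. by apply: null_potentialU => //; exact: null_potential_shift. Qed.

Let z_der h t : 0 < h -> 0 < t -> has_derivative (z h) t (Dz h t).
Proof.
move=> h0 t0; apply: has_derivativeB; last exact: v_der.
by apply: has_derivative_shift; apply: v_der; exact: addr_gt0.
Qed.

Let Dz_ac h a b : 0 < h -> 0 < a -> a < b -> chain_ac a b (Dz h).
Proof.
move=> h0 a0 ab; apply: chain_acB; last exact: D_ac.
by apply: chain_ac_shift; apply: D_ac; [exact: addr_gt0|rewrite ltrD2r].
Qed.

Let Dz_der h t : 0 < h -> 0 < t -> ~ Nz h t ->
  exists2 w, has_derivative (Dz h) t w & 0 <= J (z h t) w.
Proof.
move=> h0 t0 /not_orP[Nth Nt].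
have [w Dw Aw] := D_der (addr_gt0 t0 h0) Nth.
have [w' Dw' Aw'] := D_der t0 Nt.
exists (w - w'); last exact: A_acc.
by apply: has_derivativeB => //; exact: has_derivative_shift.
Qed.

Let z_bounded h : 0 < h -> exists K : R, forall t, 0 < t -> `|z h t| <= K.
Proof.
move=> h0; have [K K0 KP] := v_bounded; exists (K + K) => t t0.
by apply: le_trans (ler_normB _ _) _; rewrite lerD// KP// addr_gt0.
Qed.

(* The energy identity for v(t + h) - v(t), divided by h^2, with h -> 0:
   over [tau, tau + 1] the square integral of v'' is O(1 / tau). *)
Lemma small_second_derivative (eta : R) : 0 < eta -> exists t0 : R,
  forall tau, t0 <= tau -> exists t w, [/\ tau <= t, A (v t) w & `|w| <= eta].
Proof.
move=> eta0; pose L := `|D 1| + 1; have L0 : 0 < L by rewrite ltr_wpDl.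
have Me : 0 < M * eta ^+ 2 by rewrite mulr_gt0// exprn_gt0.
(* From this time on [L^2 < M eta^2 (tau - 1)], which the last estimate contradicts. [L] bounds the
   difference quotients of [v] at time 1 for small positive [h]; the flow is started there because
   only positive times are available. *)
exists (2 + L ^+ 2 / (M * eta ^+ 2)) => tau tau_ge.
have tau1 : L ^+ 2 < M * eta ^+ 2 * (tau - 1).
  by rewrite mulrC -ltr_pdivrMr//; lra.
have tau2 : 2 <= tau.
  by apply: le_trans tau_ge; rewrite lerDl divr_ge0 ?sqr_ge0// ltW.
apply: contrapT => no_t.
have big_w t w : tau <= t -> A (v t) w -> eta < `|w|.
  by move=> tt Aw; rewrite ltNge; apply/negP => we; apply: no_t; exists t, w.
(* Total increase at most 1/2 leaves at least half of [[tau, tau + 1]] to the good points. *)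
have h20 : 0 < 2^-1 :> R by rewrite invr_gt0.
have [m [m_homo md mP]] := N0 h20.
pose psi h := pairing (z h) (Dz h).
have psi_le h s r : 0 < h -> 0 < s -> s <= r -> psi h s <= psi h r.
  move=> h0 s0 sr; apply: (flow_psi_le M0 J_mono smooth (Nz0 h)) => //.
  - by move=> t; exact: z_der.
  - by move=> a b; exact: Dz_ac.
  - by move=> t; exact: Dz_der.
have psi_sqr h s r : 0 < h -> 0 < s -> s < r ->
    M * `|z h r - z h s| ^+ 2 <= (psi h r - psi h s) * (r - s).
  move=> h0 s0 sr; apply: (flow_energy M0 J_mono smooth (Nz0 h)) => //.
  - by move=> t; exact: z_der.
  - by move=> a b; exact: Dz_ac.
  - by move=> t; exact: Dz_der.
(* Subtracting the increase of [m] makes the left side nonpositive around an exceptional point,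
   where monotonicity of [psi h] is then enough. The threshold on [h] depends on the interval, and
   the transitivity step takes the minimum of two. *)
have [h0 h0_gt0 h0P] : exists2 h0 : R, 0 < h0 & forall h, 0 < h -> h < h0 ->
    h ^+ 2 * (M * eta ^+ 2) * ((tau + 1 - tau) - (m (tau + 1) - m tau)) <=
    psi h (tau + 1) - psi h tau.
  apply: (interval_induction (P := fun s t => exists2 h0 : R, 0 < h0 &
    forall h, 0 < h -> h < h0 ->
    h ^+ 2 * (M * eta ^+ 2) * ((t - s) - (m t - m s)) <= psi h t - psi h s)).
  - by rewrite lerDl.
  - move=> s t r _ _ _ _ [h1 h10 h1P] [h2 h2_0 h2P].
    exists (Num.min h1 h2) => [|h h_gt0]; first by rewrite lt_min h10.
    rewrite lt_min => /andP[/(h1P _ h_gt0) k1 /(h2P _ h_gt0) k2].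
    lra.
  - move=> t taut tt; have t_gt0 : 0 < t by lra.
    have [Nt|Nt] := pselect (N t).
      have [d d0 dP] := mP t Nt; exists d => // s r ts st tr rt rs.
      exists 1 => // h h_gt0 _; apply: (@le_trans _ _ 0).
        apply: mulr_ge0_le0; first by rewrite mulr_ge0 ?sqr_ge0 ?(ltW Me).
        by rewrite subr_le0; exact: dP.
      by rewrite subr_ge0; apply: psi_le => //; [lra|exact: le_trans tr].
    have [w Dw Aw] := D_der t_gt0 Nt.
    have we := big_w t w taut Aw.
    pose g := (`|w| - eta) / 2; have g0 : 0 < g by rewrite divr_gt0// subr_gt0.
    have [d d0 dP] := Dw g g0; exists d => // s r ts st tr rt rs.
    (* Since [|w| = eta + 2 g], one [g] pays for replacing [w] by the difference quotient of [D];
       the other is split between the difference quotients of [v] at [r] and at [s]. *)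
    have s_gt0 : 0 < s by lra.
    have sr := le_trans st tr.
    move: sr; rewrite le_eqVlt => /predU1P[<-|sr].
      by exists 1 => // h _ _; rewrite !subrr mulr0.
    have r_gt0 : 0 < r by lra.
    have rs0 : 0 < r - s by rewrite subr_gt0.
    have Drs : (eta + g) * (r - s) <= `|D r - D s|.
      have k1 := dP r; rewrite ger0_norm ?subr_ge0// in k1.
      have k2 := dP s; rewrite ler0_norm ?subr_le0// opprB in k2.
      have {k1} : `|D r - D t - (r - t) *: w| <= g * (r - t) by apply: k1; lra.
      have {k2} : `|D s - D t - (s - t) *: w| <= g * (t - s) by apply: k2; lra.
      have : `|(r - s) *: w| = (r - s) * (eta + 2 * g).
        by rewrite normrZ gtr0_norm// /g; lra.
      have -> : (r - s) *: w = (D r - D s) - (D r - D t - (r - t) *: w) +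
          (D s - D t - (s - t) *: w).
        apply: (scalar_separates M0 J_mono) => f lf.
        rewrite !(scalar_funD lf, scalar_funN lf, scalar_funZ lf); ring.
      set E1 := D r - D t - _; set E2 := D s - D t - _.
      have := ler_normD (D r - D s - E1) E2; have := ler_normB (D r - D s) E1.
      lra.
    have c0 : 0 < g * (r - s) / 2 by rewrite divr_gt0// mulr_gt0.
    have [h1 h10 h1P] := v_der r_gt0 c0.
    have [h2 h2_0 h2P] := v_der s_gt0 c0.
    exists (Num.min h1 h2) => [|h h_gt0]; first by rewrite lt_min h10.
    rewrite lt_min => /andP[hh1 hh2].
    have k1 := h1P (r + h); have k2 := h2P (s + h).
    have er : r + h - r = h by ring.
    have es : s + h - s = h by ring.
    rewrite er gtr0_norm// in k1; rewrite es gtr0_norm// in k2.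
    have {k1} k1 := k1 hh1; have {k2} k2 := k2 hh2.
    have zrs : h * (eta * (r - s)) <= `|z h r - z h s|.
      have k3 : h * ((eta + g) * (r - s)) <= `|h *: (D r - D s)|.
        by rewrite normrZ gtr0_norm// ler_wpM2l// ltW.
      move: k3; have -> : h *: (D r - D s) = (z h r - z h s) -
          (v (r + h) - v r - h *: D r) + (v (s + h) - v s - h *: D s).
        apply: (scalar_separates M0 J_mono) => f lf.
        rewrite /z !(scalar_funD lf, scalar_funN lf, scalar_funZ lf); ring.
      move: k1 k2; set E1 := v (r + h) - v r - _; set E2 := v (s + h) - v s - _.
      have := ler_normD (z h r - z h s - E1) E2; have := ler_normB (z h r - z h s) E1.
      lra.
    have k4 := psi_sqr h s r h_gt0 s_gt0 sr.
    have k5 : M * (h * (eta * (r - s))) ^+ 2 <= M * `|z h r - z h s| ^+ 2.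
      rewrite ler_wpM2l ?(ltW M0)// lerXn2r ?nnegrE//.
      by rewrite !mulr_ge0// ltW.
    have k6 : h ^+ 2 * (M * eta ^+ 2) * (r - s) <= psi h r - psi h s.
      rewrite -(ler_pM2r rs0); apply: le_trans k4; apply: le_trans k5.
      by rewrite le_eqVlt; apply/orP; left; apply/eqP; ring.
    apply: le_trans k6; rewrite (ler_wpM2l (mulr_ge0 (sqr_ge0 _) (ltW Me)))//.
    by rewrite gerBl subr_ge0 m_homo// ltW.
have [h1 h10 h1P] := v_der ltr01 ltr01.
pose h := Num.min (h0 / 2) (h1 / 2).
have h_gt0 : 0 < h by rewrite lt_min !divr_gt0.
have hh0 : h < h0.
  have : h <= h0 / 2 by rewrite ge_min lexx.
  lra.
have hh1 : h < h1.
  have : h <= h1 / 2 by rewrite ge_min lexx orbT.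
  lra.
have lower := h0P h h_gt0 hh0.
have upper : - psi h tau * (2 * (tau - 1)) <= `|z h 1| ^+ 2.
  apply: (flow_psi_decay M0 J_mono smooth (Nz0 h)) => //; last lra.
  - by move=> t; exact: z_der.
  - by move=> a b; exact: Dz_ac.
  - by move=> t; exact: Dz_der.
have psi_neg : psi h (tau + 1) <= 0.
  apply: (flow_psi_le0 M0 J_mono smooth (Nz0 h)) => //; last lra.
  - by move=> t; exact: z_der.
  - by move=> a b; exact: Dz_ac.
  - by move=> t; exact: Dz_der.
  - exact: z_bounded.
have z1 : `|z h 1| <= L * h.
  have := h1P (1 + h); have -> : 1 + h - 1 = h by ring.
  rewrite gtr0_norm// => /(_ hh1) k.
  have -> : z h 1 = (v (1 + h) - v 1 - h *: D 1) + h *: D 1 by rewrite subrK.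
  by apply: le_trans (ler_normD _ _) _; rewrite normrZ gtr0_norm// /L; lra.
have z1_sqr : `|z h 1| ^+ 2 <= h ^+ 2 * L ^+ 2.
  rewrite -exprMn lerXn2r ?nnegrE// ?mulr_ge0 ?(ltW L0) ?(ltW h_gt0)//.
  by rewrite mulrC.
have hsq : 0 < h ^+ 2 by rewrite exprn_gt0.
(* Both the lower bound on [- psi h tau] and the upper bound on [|z h 1|^2] carry the factor [h^2],
   which cancels: one small [h] suffices and no limit is taken. *)
have half : h ^+ 2 * (M * eta ^+ 2) * 2^-1 <= - psi h tau.
  apply: (@le_trans _ _ (psi h (tau + 1) - psi h tau)); last lra.
  apply: le_trans lower; rewrite (ler_wpM2l (mulr_ge0 (sqr_ge0 _) (ltW Me)))//.
  have := md tau (tau + 1); lra.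
have : h ^+ 2 * (M * eta ^+ 2 * (tau - 1)) <= h ^+ 2 * L ^+ 2.
  apply: le_trans z1_sqr; apply: le_trans upper.
  have : h ^+ 2 * (M * eta ^+ 2) * 2^-1 * (2 * (tau - 1)) <= - psi h tau * (2 * (tau - 1)).
    by rewrite ler_wpM2r//; lra.
  lra.
by rewrite ler_pM2l// leNgt tau1.
Qed.

End orbit.

(** * Convergence *)

Lemma bounded_funI {R : realType} {V : normedModType R} (f : nat -> V) (K : R) :
  (forall n, `|f n| <= K) -> bounded_fun f.
Proof.
move=> fK; exists K; split; first exact: num_real.
by move=> y Ky n _; exact: le_trans (fK n) (ltW Ky).
Qed.

(** The bound [K] makes the real-valued supremum behind [limn_inf] a genuine one: if [d] stayed
    above [e], so would its first tail infimum, which lies below that supremum. *)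
Lemma limn_inf0_lt {R : realType} (d : nat -> R) (K e : R) :
  (forall n, `|d n| <= K) -> limn_inf d = 0 -> 0 < e -> exists n, d n < e.
Proof.
move=> dK + e0; apply: contraPP => /forallNP de.
have {}de n : e <= d n by rewrite leNgt; exact/negP/de.
have d_le n : infs d n <= K.
  apply: (@le_trans _ _ (d n)); last exact: le_trans (ler_norm _) (dK n).
  by apply: ge_inf; [exists e => _ [k _ <-]|exists n => /=].
have d_ge : e <= infs d 0.
  by apply: lb_le_inf; [exists (d 0%N), 0%N|move=> _ [k _ <-]].
rewrite limn_infE; last exact: (@bounded_funI R R^o d K).
move=> d0; have : infs d 0 <= 0.
  by rewrite -d0; apply: ub_le_sup; [exists K => _ [n _ <-]|exists 0%N].
lra.
Qed.

Section convergence.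
Context {R : realType} {X : completeNormedModType R} (M : R).
Hypotheses (M0 : 0 < M) (J_mono : strongly_monotone_duality X M).
Hypothesis smooth : uniformly_smooth X.
Variable A : X -> set X.
Hypotheses (A_macc : m_accretive A) (A_conv : convergence_condition A).
Hypothesis A_zeros : zeros A !=set0.

Lemma solution_approaches_zeros x (v : R -> X) (e : R) :
  incomplete_cauchy_solution A x v -> 0 < e ->
  exists t p, [/\ 0 <= t, zeros A p & `|v t - p| < e].
Proof.
move=> v_sol e0; have [A_acc _] := A_macc; have [p0 Ap0] := A_zeros.
have /choice[t tP] n : exists t, 0 <= t /\
    exists2 w, A (v t) w & `|w| <= n.+1%:R^-1.
  have n0 : 0 < n.+1%:R^-1 :> R by rewrite invr_gt0.
  have [t0 t0P] := small_second_derivative M0 J_mono smooth A_acc v_sol n0.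
  have [|t [w [tt Aw we]]] := t0P (Num.max t0 0); first by rewrite le_max lexx.
  by exists t; split; [apply: le_trans tt; rewrite le_max lexx orbT|exists w].
have /choice[w wP] n : exists w, A (v (t n)) w /\ `|w| <= n.+1%:R^-1.
  by have [_ [w Aw we]] := tP n; exists w.
have dist0 n : `|v (t n) - p0| <= `|x - p0|.
  exact: (solution_dist_zero M0 J_mono smooth A_acc v_sol Ap0 (tP n).1).
set P := nearest_point (zeros A).
have [P_zero P_le] : (forall y, zeros A (P y)) /\
    forall y q, zeros A q -> `|y - P y| <= `|y - q|.
  by split=> y; have [] := nearest_zeroP M0 J_mono A_macc y A_zeros.
have dist_le n : `|v (t n) - P (v (t n))| <= `|x - p0|.
  exact: le_trans (P_le _ _ Ap0) (dist0 n).
have [|||n nP] := @limn_inf0_lt R (fun n => `|v (t n) - P (v (t n))|) `|x - p0| e.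
- by move=> n; rewrite normr_id.
- apply: (A_conv (x := fun n => v (t n)) (y := w)).
  + by move=> n; exact: (wP n).1.
  + apply: (@bounded_funI _ _ _ (`|x - p0| + `|p0|)) => n.
    by have := lerB_dist (v (t n)) p0; have := dist0 n; lra.
  + apply: (@bounded_funI _ _ _ 1) => n; apply: le_trans (wP n).2 _.
    by rewrite invf_le1// ler1n.
  + apply/cvgrPdist_lt => r r0.
    have r'0 : 0 < r / (`|x - p0| + 1) by rewrite divr_gt0// ltr_wpDl.
    have [n0 _ n0P] := near_infty_natSinv_lt (PosNum r'0).
    exists n0 => // n /= /n0P /= nr; rewrite sub0r normrN.
    apply: le_lt_trans (J_norm M0 J_mono _ _) _.
    apply: (@le_lt_trans _ _ ((`|x - p0| + 1) * n.+1%:R^-1)).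
      rewrite ler_pM ?(wP n).2//; apply: le_trans (dist_le n) _.
      by rewrite lerDl.
    by rewrite mulrC -ltr_pdivlMr// ltr_wpDl.
- exact: e0.
by exists (t n), (P (v (t n))); split => //; exact: (tP n).1.
Qed.

(** * From solutions to the semigroup and its almost-orbits *)

Section semigroup.
Variable T : R -> X -> X.
Hypothesis T_semi : incomplete_cauchy_semigroup A T.

Lemma zeros_dom p : zeros A p -> dom A p. Proof. by move=> Ap; exists 0. Qed.

Lemma semigroup_fixes_zeros p t : zeros A p -> 0 <= t -> T t p = p.
Proof.
move=> Ap t0; have [_ /(_ _ (zeros_dom Ap)) p_sol] := T_semi.
have [A_acc _] := A_macc.
have := solution_dist_zero M0 J_mono smooth A_acc p_sol Ap t0.
by rewrite subrr normr0 normr_le0 subr_eq0 => /eqP.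
Qed.

Lemma semigroup_dist_zero p x t : zeros A p -> closure (dom A) x -> 0 <= t ->
  `|T t x - p| <= `|x - p|.
Proof.
move=> Ap Cx t0; rewrite -{1}(semigroup_fixes_zeros Ap t0).
have [[_ _ _ _ T_nonexp] _] := T_semi; apply: T_nonexp => //.
exact/subset_closure/zeros_dom.
Qed.

(** The Cauchy problem is posed on [dom A] only; a point of the closure is replaced by a nearby
    point of [dom A], and nonexpansiveness keeps the two orbits close. *)
Lemma semigroup_approaches_zeros x (e : R) : closure (dom A) x -> 0 < e ->
  exists t p, [/\ 0 <= t, zeros A p & `|T t x - p| < e].
Proof.
move=> Cx e0; have e20 : 0 < e / 2 by rewrite divr_gt0.
have [|x' [Ax']] := Cx (ball x (e / 2)); first exact: nbhsx_ballx.
rewrite -ball_normE /= => xx'.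
have [[_ _ _ _ T_nonexp] /(_ _ Ax') x'_sol] := T_semi.
have [t [p [t0 Ap tp]]] := solution_approaches_zeros x'_sol e20.
exists t, p; split => //.
have := T_nonexp t x x' t0 Cx (subset_closure Ax').
by have := ler_distD (T t x') (T t x) p; lra.
Qed.

(** Once [u r] is close to a zero [p] at a late time [r], it stays close: the orbit of [u r] under
    [T] does not move away from [p], and [u] follows that orbit uniformly in time. *)
Lemma almost_orbit_cvg (u : R -> X) : almost_orbit (closure (dom A)) T u ->
  exists l : X, u t @[t --> +oo] --> l.
Proof.
move=> [_ uC /fine_cvgP[u_fin /cvgrPdist_lt u_lim]].
apply: cauchy_cvg_dist => e e0; have e20 : 0 < e / 4 by rewrite divr_gt0.
have [s [s0 sP]] : exists s, 0 <= s /\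
    forall r t, s <= r -> 0 <= t -> `|u (t + r) - T t (u r)| < e / 4.
  have [k [_ kP]] := u_fin; have [k' [_ k'P]] := u_lim _ e20.
  (* Neighbourhoods of [+oo] are given by strict inequalities, hence the shift by 1. *)
  exists (Num.max 0 (Num.max k k' + 1)); split; first by rewrite le_max lexx.
  move=> r t; rewrite ge_max => /andP[_ kr] t0.
  have kr1 : k < r by apply: lt_le_trans kr; rewrite ltr_pwDr// le_max lexx.
  have kr2 : k' < r by apply: lt_le_trans kr; rewrite ltr_pwDr// le_max lexx orbT.
  have := k'P r kr2; rewrite /= sub0r normrN => /(le_lt_trans (ler_norm _)).
  apply: le_lt_trans; rewrite -lee_fin fineK; last exact: kP.
  by apply: ereal_sup_ubound; exists t => //=; rewrite in_itv /= t0.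
have [t [p [t0 Ap tp]]] := semigroup_approaches_zeros (uC s s0) e20.
pose r := t + s.
have sr : s <= r by rewrite lerDr.
have r0 : 0 <= r by exact: le_trans sr.
have ur : `|u r - p| < e / 2.
  by have := sP s t (lexx s) t0; have := ler_distD (T t (u s)) (u r) p; rewrite -/r; lra.
exists p; exists r; split; first exact: num_real.
move=> q rq; rewrite distrC.
have q0 : 0 <= q - r by rewrite subr_ge0 ltW.
have := sP r (q - r) sr q0; rewrite subrK.
have := semigroup_dist_zero Ap (uC r r0) q0.
have := ler_distD (T (q - r) (u r)) (u q) p; lra.
Qed.

End semigroup.
End convergence.

(** The definition of [square_root] only provides some semigroup given by the Cauchy problem; the
    exponential formula identifies it with the given one. *)
Lemma generates_unique {R : realType} {X : normedModType R} (B : X -> set X)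
    (S T : R -> X -> X) x t : generates B S -> generates B T ->
  closure (dom B) x -> 0 <= t -> S t x = T t x.
Proof.
move=> BS BT Cx; have [S0 St] := BS x Cx; have [T0 Tt] := BT x Cx.
rewrite le_eqVlt => /predU1P[<-|t0]; first by rewrite S0 T0.
by apply: cvg_unique (St t t0) (Tt t t0); exact: norm_hausdorff.
Qed.

Theorem theorem1p3 (R : realType) (X : completeNormedModType R) (M : R)
    (A A12 : X -> set X) (S : R -> X -> X) (u : R -> X) :
  uniformly_convex X -> uniformly_smooth X ->
  0 < M -> strongly_monotone_duality X M ->
  m_accretive A -> convergence_condition A -> zeros A !=set0 ->
  square_root A A12 -> generates A12 S ->
  almost_orbit (closure (dom A)) S u ->
  exists l : X, u t @[t --> +oo] --> l.
Proof.
move=> _ smooth M0 J_mono A_macc A_conv A_zeros.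
move=> [_ dom_eq [T [T_semi T_gen]]] S_gen [u_cont uC u_lim].
apply: (almost_orbit_cvg M0 J_mono smooth A_macc A_conv A_zeros T_semi).
split => //; apply: cvg_trans u_lim; apply: near_eq_cvg.
(* The point [u s] is known to lie in the closure of the domain only for [s >= 0], so the suprema
   are compared for large [s]. *)
near=> s; congr ereal_sup; apply: eq_imagel => t /=.
rewrite in_itv /= andbT => t0; congr (`|_ - _|%:E).
apply: (generates_unique S_gen T_gen) => //; rewrite dom_eq; apply: uC.
by near: s; exact: nbhs_pinfty_ge.
Unshelve. all: by end_near.
Qed.
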